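(* Put $\mathcal{S}_{2,+}=\{\kappa\in\mathcal{S}_2 : I+B_\kappa\ge0\}$, $\widehat{\mathcal{S}_{2,+}}=\{\kappa\in\mathcal{S}_{2,+} : \Lambda(B_{\eta(\kappa)})<1\}$, and $\widehat{\mathcal{S}_2}=\{\eta\in\mathcal{S}_2 : \Lambda(B_\eta)<1\}$. (i) If $\kappa_1,\kappa_2\in\mathcal{S}_{2,+}$ and $\eta(\kappa_1)=\eta(\kappa_2)$ in $\mathcal{L}_2$, then $\kappa_1=\kappa_2$ in $\mathcal{L}_2$. (ii) The mapping $\widehat{\mathcal{S}_{2,+}}\ni\kappa\mapsto\eta(\kappa)\in\widehat{\mathcal{S}_2}$ is bijective in the sense that $\kappa_1=\kappa_2$ in $\mathcal{L}_2$ if $\kappa_1,\kappa_2\in\widehat{\mathcal{S}_{2,+}}$ and $\eta(\kappa_1)=\eta(\kappa_2)$ in $\mathcal{L}_2$, and each $\eta\in\widehat{\mathcal{S}_2}$ admits a $\kappa\in\widehat{\mathcal{S}_{2,+}}$ with $\eta=\eta(\kappa)$ in $\mathcal{L}_2$.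
   Context: Fix $T>0$ and $d\in\mathbb{N}$. $\mathcal{H}$ is the Cameron-Martin space of absolutely continuous $h:[0,T]\to\mathbb{R}^d$ with $h(0)=0$ and square integrable derivative $h'$, with inner product $\langle h,g\rangle_{\mathcal{H}}=\int_0^T\langle h'(t),g'(t)\rangle dt$; $I$ is the identity of $\mathcal{H}$. $\mathcal{L}_2$ is the space of square integrable functions $\kappa:[0,T]^2\to\mathbb{R}^{d\times d}$ with norm $\|\kappa\|_2=(\int_0^T\int_0^T|\kappa(t,s)|^2dsdt)^{1/2}$ ($|\cdot|$ the Euclidean norm on matrices); $\kappa=\kappa'$ in $\mathcal{L}_2$ means $\|\kappa-\kappa'\|_2=0$. $\mathcal{S}_2=\{\eta\in\mathcal{L}_2:\eta(t,s)^\dagger=\eta(s,t)\}$, where $\dagger$ is matrix transpose. Matrices act on column vectors from the left. For $\kappa\in\mathcal{L}_2$, the Hilbert-Schmidt operator $B_\kappa:\mathcal{H}\to\mathcal{H}$ is given by $\langle B_\kappa h,g\rangle_{\mathcal{H}}=\int_0^T\langle\int_0^T\kappa(t,s)h'(s)ds,g'(t)\rangle dt$ for $h,g\in\mathcal{H}$, and $\eta(\kappa)\in\mathcal{S}_2$ by $\eta(\kappa)(t,s)=-\{\kappa(t,s)+\kappa(s,t)^\dagger+\int_0^T\kappa(u,t)^\dagger\kappa(u,s)du\}$. For a self-adjoint Hilbert-Schmidt operator $B$ on $\mathcal{H}$, $\Lambda(B)=\sup_{\|h\|_{\mathcal{H}}=1}\langle Bh,h\rangle_{\mathcal{H}}$.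 For a self-adjoint continuous operator $C$ on $\mathcal{H}$, $C\ge0$ means $\langle Ch,h\rangle_{\mathcal{H}}\ge0$ for every $h\in\mathcal{H}$. *)

(* Defs.v *)
From HB Require Import structures.
From mathcomp Require Import all_boot all_order all_algebra.
From mathcomp Require Import all_classical all_reals all_analysis.
Set Implicit Arguments.
Unset Strict Implicit.
Unset Printing Implicit Defensive.
Import Order.TTheory GRing.Theory Num.Theory.
Import numFieldNormedType.Exports.
Local Open Scope classical_set_scope.
Local Open Scope ring_scope.

Section EuclideanMatrices.
Context {R : realType}.

Definition dotp (d : nat) (u v : 'cV[R]_d) : R := \sum_(i < d) u i 0 * v i 0.

(* The norm `|A| which the library puts on matrices is the maximum norm. *)
Definition enorm (m n : nat) (A : 'M[R]_(m, n)) : R :=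
  Num.sqrt (\sum_(i < m) \sum_(j < n) A i j ^+ 2).

Definition mx_integral (m n : nat) (D : set R) (F : R -> 'M[R]_(m, n)) :
    'M[R]_(m, n) :=
  \matrix_(i, j) \int[lebesgue_measure]_(t in D) F t i j.

End EuclideanMatrices.

Section L2.
Context {disp : measure_display} {X : measurableType disp} {R : realType}.
Context (mu : {measure set X -> \bar R}) (D : set X) {m n : nat}.
Implicit Types F G : X -> 'M[R]_(m, n).

Definition L2norm F : \bar R :=
  sqrte (\int[mu]_(x in D) ((enorm (F x)) ^+ 2)%:E)%E.

Definition square_integrable F : Prop :=
  (forall i j, measurable_fun D (fun x => F x i j)) /\ (L2norm F < +oo)%E.

Definition L2eq F G : Prop := L2norm (fun x => F x - G x) = 0%E.

End L2.

Section CameronMartin.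
Context {R : realType} (T : R) (d : nat).
Local Notation mu := (@lebesgue_measure R).
Local Notation path := (R -> 'cV[R]_d).
Implicit Types h g : path.

Definition absolutely_continuous h : Prop :=
  forall eps : R, 0 < eps -> exists2 delta : R, 0 < delta &
    forall (n : nat) (a b : 'I_n -> R),
      (forall i, [/\ 0 <= a i, a i <= b i & b i <= T]) ->
      trivIset setT (fun i => `]a i, b i[%classic) ->
      \sum_(i < n) (b i - a i) < delta ->
      \sum_(i < n) enorm (h (b i) - h (a i)) < eps.

(* The derivative of an absolutely continuous path exists only almost
   everywhere, so it is a class of functions; the members of the class below
   are its Borel measurable and square integrable representatives. *)
Definition is_L2_derivative h (v : path) : Prop :=
  square_integrable mu `[0, T] v /\
  {ae mu, forall t, `]0, T[%classic t -> is_derive t 1 h (v t)}.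

(* Paths are functions on the whole line, of which only the values on [0, T]
   matter. *)
Definition cameron_martin h : Prop :=
  [/\ absolutely_continuous h, h 0 = 0 & exists v, is_L2_derivative h v].

Definition cm_deriv h : path := get (is_L2_derivative h).

Definition cm_inner h g : R :=
  \int[mu]_(t in `[0, T]) dotp (cm_deriv h t) (cm_deriv g t).

Definition cm_norm h : R := Num.sqrt (cm_inner h h).

Definition cm_nonneg (C : path -> path) : Prop :=
  forall h, cameron_martin h -> 0 <= cm_inner (C h) h.

(* For d = 0 there is no unit vector and the supremum is -oo. *)
Definition cm_Lambda (B : path -> path) : \bar R :=
  ereal_sup [set (cm_inner (B h) h)%:E | h in
               [set h | cameron_martin h /\ cm_norm h = 1]].

End CameronMartin.

Section Kernels.
Context {R : realType} (T : R) (d : nat).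
Local Notation mu := (@lebesgue_measure R).
Local Notation path := (R -> 'cV[R]_d).
Local Notation kernel := (R * R -> 'M[R]_d).
Local Notation square := (`[0, T]%classic `*` `[0, T]%classic).
Implicit Types k eta : kernel.

Definition kernel_L2 k : Prop := square_integrable (mu \x mu)%E square k.

Definition kernel_eq k k' : Prop := L2eq (mu \x mu)%E square k k'.

(* Elements of L2 are identified almost everywhere, so the symmetry is required
   almost everywhere as well. *)
Definition kernel_S2 eta : Prop :=
  kernel_L2 eta /\
  {ae (mu \x mu)%E, forall p, square p -> (eta p)^T = eta (p.2, p.1)}.

Definition hs_form k (h g : path) : R :=
  \int[mu]_(t in `[0, T])
    dotp (mx_integral `[0, T] (fun s => k (t, s) *m cm_deriv T h s))
         (cm_deriv T g t).

(* hs_op k h is the Riesz representative of hs_form k h, which is unique on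
   [0, T]. *)
Definition hs_op k (h : path) : path :=
  get [set f | cameron_martin T f /\
               forall g, cameron_martin T g -> cm_inner T f g = hs_form k h g].

Definition eta_of k : kernel := fun p =>
  - (k (p.1, p.2) + (k (p.2, p.1))^T
     + mx_integral `[0, T] (fun u => (k (u, p.1))^T *m k (u, p.2))).

Definition kernel_S2plus k : Prop :=
  kernel_S2 k /\ cm_nonneg T (fun h => h \+ hs_op k h).

Definition kernel_S2plus_hat k : Prop :=
  kernel_S2plus k /\ (cm_Lambda T (hs_op (eta_of k)) < 1)%E.

Definition kernel_S2_hat eta : Prop :=
  kernel_S2 eta /\ (cm_Lambda T (hs_op eta) < 1)%E.

End Kernels.

(* Main.v *)
(** With S = I - B_eta(k), the equation eta = eta(k) says S = (I + B_k)^2, so (i)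
    is uniqueness of nonnegative square roots and (ii) their existence for
    S >= c > 0. Both are proved inside the Hilbert algebra of matrices of L2
    kernels under composition, with the inner product of L2. Uniqueness: if
    X = 1 + x and Y = 1 + y are nonnegative with X^2 = Y^2 and d = x - y, then
    X d + d Y = 0, and pairing with d kills both terms. Existence: for
    a^2 <= S <= b^2 the map X |-> X - (X^2 - S) / (2 b) preserves the operators
    between a and b and is a contraction for the L2 norm; completeness gives the
    fixed point. Positivity on kernels is equivalent to positivity on vector
    functions (test on the columns), hence on the Cameron-Martin space, whose
    derivatives exhaust L2 by the Lebesgue differentiation theorem.

    The laws of the algebra hold almost everywhere only, so they are stated
    weakly, tested by the inner product. *)
From HB Require Import structures.
Require Import Defs.
From mathcomp Require Import all_boot all_order all_algebra.
From mathcomp Require Import all_classical all_reals all_analysis.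
From mathcomp Require Import measurable_realfun.
From mathcomp Require Import ring lra.
Import Order.TTheory GRing.Theory Num.Theory.
Import numFieldNormedType.Exports.
Local Open Scope classical_set_scope.
Local Open Scope ring_scope.
Set Implicit Arguments.
Unset Strict Implicit.
Unset Printing Implicit Defensive.

(** The square root must have the form 1 + x with x a kernel, so the iteration has to converge in
    the Hilbert-Schmidt norm and not merely in operator norm. It does, because the difference of two
    steps multiplies D = x - y, on the left or on the right, by operators 1/2 - X / (2 b) of norm at
    most (1 - a / b) / 2, and a bounded factor on either side scales the L2 norm of D by at most its
    operator norm; the rate is 1 - a / b. Order relations are between quadratic forms of left
    multiplications and are handled by Cauchy-Schwarz for semidefinite forms, so neither spectral
    theorem nor functional calculus enters. The lower bound of S comes from Lambda < 1, the upper
    one from the Hilbert-Schmidt norm of eta. Functions that agree almost everywhere are not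
    identified: [ip] is only semidefinite, and [ip x w = ip y w] for all w plays the role of x = y.
    The dimension d is separated from the analysis: matrices over such an algebra form such an
    algebra again, so the laws need integrals for scalar kernels only. *)

Record hilbert_algebra (R : realType) := HilbertAlgebra {
  halg :> lmodType R;
  ip : halg -> halg -> R;
  hmul : halg -> halg -> halg;
  hstar : halg -> halg;
  hbnd : R;
  ipC : forall x y, ip x y = ip y x;
  ip_linl : forall a x y z, ip (a *: x + y) z = a * ip x z + ip y z;
  ip_ge0 : forall x, 0 <= ip x x;
  hmul_linl : forall a x y z w,
    ip (hmul (a *: x + y) z) w = a * ip (hmul x z) w + ip (hmul y z) w;
  hmulA : forall x y z w, ip (hmul x (hmul y z)) w = ip (hmul (hmul x y) z) w;
  hmul_adj : forall x y z, ip (hmul x y) z = ip y (hmul (hstar x) z);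
  hstar_adj : forall x y, ip (hstar x) y = ip x (hstar y);
  hstarK : forall x y, ip (hstar (hstar x)) y = ip x y;
  hstar_mul : forall x y z, ip (hstar (hmul x y)) z = ip (hmul (hstar y) (hstar x)) z;
  hbnd_ge0 : 0 <= hbnd;
  hmul_bnd : forall x y, ip (hmul x y) (hmul x y) <= hbnd * (ip x x * ip y y);
  hcomplete : forall (u : nat -> halg) (C r : R), 0 <= r < 1 ->
    (forall n, ip (u n.+1 - u n) (u n.+1 - u n) <= C * r ^+ n) ->
    exists x, forall e : R, 0 < e ->
      exists N, forall n, (N <= n)%N -> ip (u n - x) (u n - x) <= e
}.

(** * Cauchy-Schwarz for semidefinite forms *)

Section QuadraticForms.
Context {R : realType}.

Lemma discriminant_le (a b c : R) : 0 <= a ->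
  (forall t, 0 <= a + 2 * t * b + t ^+ 2 * c) -> b ^+ 2 <= a * c.
Proof.
move=> a0 h.
have c0 : 0 <= c.
  case: (ltrP c 0) => // c0.
  have b2 := sqr_ge0 b.
  (* The values at t and -t add up to 2 a + 2 t^2 c, where b has cancelled; this t satisfies t^2
     (-c) > a, which refutes c < 0. *)
  have := h (1 + (a + b ^+ 2 + 1) / - c + 1).
  have := h (- (1 + (a + b ^+ 2 + 1) / - c + 1)).
  set t := 1 + _ + 1 => h1 h2.
  have ht : (t - 2) * - c = a + b ^+ 2 + 1.
    by rewrite /t; field; rewrite lt_eqF.
  nra.
case: (eqVneq c 0) => [c00|cn0].
  rewrite c00 in h *.
  case: (eqVneq b 0) => [->|bn0]; first by rewrite expr0n mulr0.
  have := h (- (a + 1) / (2 * b)).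
  have -> : a + 2 * (- (a + 1) / (2 * b)) * b + (- (a + 1) / (2 * b)) ^+ 2 * 0 = -1.
    by field.
  by lra.
have {}c0 : 0 < c by rewrite lt_def cn0.
have := h (- b / c).
have -> : a + 2 * (- b / c) * b + (- b / c) ^+ 2 * c = (a * c - b ^+ 2) / c by field.
by rewrite pmulr_lge0 ?invr_gt0// subr_ge0.
Qed.

(** Semidefiniteness is all that is available: the lemma serves for [ip], which has null vectors,
    and for the form of a nonnegative operator. *)
Lemma psd_cauchy_schwarz (U : lmodType R) (phi : U -> U -> R) :
  (forall x y, phi x y = phi y x) ->
  (forall a x y z, phi (a *: x + y) z = a * phi x z + phi y z) ->
  (forall x, 0 <= phi x x) -> forall x y, phi x y ^+ 2 <= phi x x * phi y y.
Proof.
move=> sym lin ge0 x y; apply: discriminant_le => // t.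
have := ge0 (t *: y + x).
by rewrite lin !(sym _ (t *: y + x)) !lin (sym y x); congr (_ <= _); ring.
Qed.

End QuadraticForms.

(** * Calculus in a Hilbert algebra: adjoints, forms and order *)

Section HilbertAlgebra.
Context {R : realType} {V : hilbert_algebra R}.
Implicit Types (a b c : R) (x y z w : V).

Lemma ip0l z : ip 0 z = 0.
Proof. by have := ip_linl (-1) (0 : V) 0 z; rewrite scaler0 addr0; lra. Qed.

Lemma ipDl x y z : ip (x + y) z = ip x z + ip y z.
Proof. by rewrite -[x in LHS]scale1r ip_linl mul1r. Qed.

Lemma ipZl a x z : ip (a *: x) z = a * ip x z.
Proof. by rewrite -[_ *: _]addr0 ip_linl ip0l addr0. Qed.

Lemma ipNl x z : ip (- x) z = - ip x z.
Proof. by rewrite -scaleN1r ipZl mulN1r. Qed.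

Lemma ipBl x y z : ip (x - y) z = ip x z - ip y z.
Proof. by rewrite ipDl ipNl. Qed.

Lemma ipDr x y z : ip z (x + y) = ip z x + ip z y.
Proof. by rewrite !(ipC z) ipDl. Qed.

Lemma ipZr a x z : ip z (a *: x) = a * ip z x.
Proof. by rewrite !(ipC z) ipZl. Qed.

Lemma ipNr x z : ip z (- x) = - ip z x.
Proof. by rewrite !(ipC z) ipNl. Qed.

Lemma ipBr x y z : ip z (x - y) = ip z x - ip z y.
Proof. by rewrite ipDr ipNr. Qed.

Definition ipE := (ipDl, ipNl, ipZl, ipDr, ipNr, ipZr).

Lemma ip_hstar x y : ip (hstar x) (hstar y) = ip x y.
Proof. by rewrite -hstar_adj hstarK. Qed.

(** Conjugate the adjoint of left multiplication by the star, which preserves [ip] and reverses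
    products. *)
Lemma hmul_adjr x y z : ip (hmul x y) z = ip x (hmul z (hstar y)).
Proof.
by rewrite -ip_hstar hstar_mul hmul_adj -(ip_hstar x) (ipC _ (hstar (hmul _ _))) hstar_mul ipC.
Qed.

Lemma hmul_linr a x y z w :
  ip (hmul z (a *: x + y)) w = a * ip (hmul z x) w + ip (hmul z y) w.
Proof. by rewrite !hmul_adj ip_linl. Qed.

Lemma ip_cauchy_schwarz x y : ip x y ^+ 2 <= ip x x * ip y y.
Proof. apply: psd_cauchy_schwarz; [exact: ipC|exact: ip_linl|exact: ip_ge0]. Qed.

(** By Cauchy-Schwarz; this is how an identity proved in norm returns to the weak form used
    everywhere else. *)
Lemma ip_eq0l x : ip x x = 0 -> forall y, ip x y = 0.
Proof.
move=> x0 y; have := ip_cauchy_schwarz x y; rewrite x0 mul0r => h.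
by apply/eqP; rewrite -sqrf_eq0 eq_le h sqr_ge0.
Qed.

Definition self_adjoint x := forall y, ip (hstar x) y = ip x y.

(** The operator a + x, acting by left multiplication. The identity is not Hilbert-Schmidt, so the
    algebra is not given a unit and a + x exists only as an operator. *)
Definition shift a x z : V := a *: z + hmul x z.

Definition nonneg a x := forall z, 0 <= ip (shift a x z) z.

Lemma hmul_sym x y z : self_adjoint x -> ip (hmul x y) z = ip (hmul x z) y.
Proof. by move=> sx; rewrite hmul_adj ipC hmul_adjr sx -hmul_adjr. Qed.

Lemma shift_sym a x y z : self_adjoint x -> ip (shift a x y) z = ip (shift a x z) y.
Proof. by move=> sx; rewrite !ipDl !ipZl hmul_sym// (ipC y). Qed.

Lemma shift_lin a x b y z w :
  ip (shift a x (b *: y + z)) w = b * ip (shift a x y) w + ip (shift a x z) w.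
Proof. by rewrite !ipDl !ipZl hmul_linr ip_linl; ring. Qed.

(* [0 <= P <= m] gives [P ^ 2 <= m P], by Cauchy-Schwarz for the form of P. *)
Lemma shift_sqr_le a x m : self_adjoint x -> nonneg a x -> 0 <= m ->
  (forall z, ip (shift a x z) z <= m * ip z z) ->
  forall z, ip (shift a x z) (shift a x z) <= m * ip (shift a x z) z.
Proof.
move=> sx nx m0 hm z.
(* With P z as second vector this reads q^2 <= p r with r <= m q, and q cancels unless it is
   zero. *)
have := @psd_cauchy_schwarz _ _ (fun y z => ip (shift a x y) z)
  (fun y z => shift_sym a y z sx) (shift_lin a x) nx z (shift a x z).
have := hm (shift a x z); have := nx z.
set p := ip (shift a x z) z.
set q := ip (shift a x z) (shift a x z); set r := ip _ (shift a x z).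
have q0 : 0 <= q by exact: ip_ge0.
move=> p0 rq qq; case: (eqVneq q 0) => [->|qn0]; first exact: mulr_ge0.
have {}q0 : 0 < q by rewrite lt_def qn0.
rewrite -(ler_pM2r q0) -expr2; apply: le_trans qq _.
by rewrite -mulrA mulrCA ler_wpM2l.
Qed.

End HilbertAlgebra.

(** * Uniqueness and existence of nonnegative square roots *)

Section SquareRoot.
Context {R : realType} {V : hilbert_algebra R}.
Implicit Types (x y z w : V).

Lemma hmulBl x y z w : ip (hmul (x - y) z) w = ip (hmul x z) w - ip (hmul y z) w.
Proof. by rewrite -[- y]scaleN1r addrC hmul_linl mulN1r addrC. Qed.

Lemma hmulBr x y z w : ip (hmul z (x - y)) w = ip (hmul z x) w - ip (hmul z y) w.
Proof. by rewrite !hmul_adj ipBl. Qed.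

Lemma hmulZl (a : R) x z w : ip (hmul (a *: x) z) w = a * ip (hmul x z) w.
Proof. by rewrite !hmul_adjr ipZl. Qed.

Lemma hstarB x y z : ip (hstar (x - y)) z = ip (hstar x) z - ip (hstar y) z.
Proof. by rewrite !hstar_adj ipBl. Qed.

(** Weak equality is a congruence for [hmul], since the other factor can be moved across [ip]; this
    replaces rewriting along x = y. *)
Lemma hmul_eql x y z w : (forall v, ip x v = ip y v) ->
  ip (hmul x z) w = ip (hmul y z) w.
Proof. by move=> xy; rewrite !hmul_adjr xy. Qed.

Lemma hmul_eqr x y z w : (forall v, ip x v = ip y v) ->
  ip (hmul z x) w = ip (hmul z y) w.
Proof. by move=> xy; rewrite !hmul_adj xy. Qed.

Lemma ip_hmul_star x y z :
  ip (hmul x y) z = ip (hmul (hstar y) (hstar x)) (hstar z).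
Proof. by rewrite -ip_hstar hstar_mul. Qed.

(** Cauchy-Schwarz for the form of a + x: a null vector of a nonnegative form is annihilated by the
    operator itself. *)
Lemma shift_eq0 a x z : self_adjoint x -> nonneg a x ->
  ip (shift a x z) z = 0 -> forall w, ip (shift a x z) w = 0.
Proof.
move=> sx nx z0 w.
have := @psd_cauchy_schwarz _ _ (fun y z => ip (shift a x y) z)
  (fun y z => shift_sym a y z sx) (shift_lin a x) nx z w.
rewrite z0 mul0r => h.
by apply/eqP; rewrite -sqrf_eq0 eq_le h sqr_ge0.
Qed.

(* With d = x - y one has (1 + x) d + d (1 + y) = 0; pairing with d gives two
   nonnegative terms, so (1 + x) d = (1 + y) d = 0 and d d = 0, whence
   <d, d> = - <x d, d> = - <x, d d> = 0. *)
Lemma square_root_unique x y : self_adjoint x -> self_adjoint y ->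
  nonneg 1 x -> nonneg 1 y ->
  (forall w, 2 * ip x w + ip (hmul x x) w = 2 * ip y w + ip (hmul y y) w) ->
  ip (x - y) (x - y) = 0.
Proof.
move=> sx sy nx ny xy; set d := x - y.
have sd : self_adjoint d by move=> w; rewrite hstarB ipBl sx sy.
(* Paired with d, right multiplication by y equals left multiplication by y, both elements being
   self-adjoint; so the second term is the form of 1 + y at d. *)
have yd : ip (hmul d y) d = ip (hmul y d) d.
  rewrite ip_hmul_star ipC sd ipC (hmul_eql _ _ sy) ; exact: hmul_eqr.
have xd w : ip (hmul x d) w = ip (hmul x x) w - ip (hmul x y) w by exact: hmulBr.
have dy w : ip (hmul d y) w = ip (hmul x y) w - ip (hmul y y) w by exact: hmulBl.
have dE w : ip d w = ip x w - ip y w by exact: ipBl.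
have h : ip (shift 1 x d) d + ip (shift 1 y d) d = 0.
  by rewrite !ipDl !ipZl -yd xd dy dE; have := xy d; lra.
have := nx d; have := ny d => y0 x0.
have xd0 : forall w, ip (shift 1 x d) w = 0 by apply: shift_eq0 => //; lra.
have yd0 : forall w, ip (shift 1 y d) w = 0 by apply: shift_eq0 => //; lra.
have dd w : ip (hmul d d) w = 0.
  have := xd0 w; have := yd0 w; rewrite !ipDl !ipZl hmulBl; lra.
have xdd : ip (hmul x d) d = ip (hmul d d) x.
  by rewrite hmul_adjr ipC; exact: hmul_eqr.
by have := xd0 d; rewrite ipDl ipZl xdd dd; lra.
Qed.

Lemma ip_add_le x y : ip (x + y) (x + y) <= 2 * (ip x x + ip y y).
Proof. by have := ip_ge0 (x - y); rewrite !ipE (ipC y x); lra. Qed.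

(** P^2 <= m P, followed by P <= m once more. *)
Lemma shift_norm_le a x m : self_adjoint x -> nonneg a x -> 0 <= m ->
  (forall z, ip (shift a x z) z <= m * ip z z) ->
  forall z, ip (shift a x z) (shift a x z) <= m ^+ 2 * ip z z.
Proof.
move=> sx nx m0 xm z; apply: (le_trans (shift_sqr_le sx nx m0 xm z)).
by rewrite expr2 -mulrA ler_wpM2l.
Qed.

(** The scalar core of the invariance of [a, b], with n = <z, z>, p = <X z, z>, q = <X z, X z> and t
    = <S z, z>. The lower bound uses (X - a)(b - X) >= 0 together with X >= a and S >= a^2; the
    upper bound uses (b - X)^2 >= 0 and S <= b^2. *)
Lemma step_bounds (a b n p q t : R) : 0 < a -> a <= 1 -> 1 <= b -> 0 <= n ->
  a * n <= p -> p <= b * n -> a ^+ 2 * n <= t -> t <= b ^+ 2 * n ->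
  q <= (a + b) * p - a * b * n -> 0 <= b ^+ 2 * n - 2 * b * p + q ->
  a * n <= p + (2 * b)^-1 * (t - q) <= b * n.
Proof.
move=> a0 a1 b1 n0 ap pb at_ tb qub qlb.
have b0 : 0 < 2 * b by lra.
have tauE u v : (u <= v) = (2 * b * u <= 2 * b * v) by rewrite ler_pM2l.
have tE : 2 * b * (p + (2 * b)^-1 * (t - q)) = 2 * b * p + (t - q).
  by field; lra.
rewrite !(tauE _ (p + _)) !(tauE (p + _)) tE; apply/andP; split; last by nra.
have : 0 <= (b - a) * (p - a * n) by rewrite mulr_ge0//; lra.
by nra.
Qed.

Section Existence.
Context (s : V) (a b : R).
Hypotheses (a0 : 0 < a) (a1 : a <= 1) (b1 : 1 <= b) (ss : self_adjoint s).
Hypothesis sa : forall z, a ^+ 2 * ip z z <= ip (shift 1 s z) z.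
Hypothesis sb : forall z, ip (shift 1 s z) z <= b ^+ 2 * ip z z.

Let tau : R := (2 * b)^-1.

(* X - tau (X ^ 2 - S) for X = 1 + x and S = 1 + s: on the operators between
   a and b it is a contraction towards the square root of S. *)
Let step x : V := x + tau *: (s - 2 *: x - hmul x x).

Let between x := self_adjoint x /\
  forall z, a * ip z z <= ip (shift 1 x z) z <= b * ip z z.

Let b0 : 0 < b := lt_le_trans ltr01 b1.

Let tau0 : 0 < tau. Proof. by rewrite invr_gt0 mulr_gt0. Qed.

Let tau2b : tau * b = 2^-1. Proof. by rewrite /tau; field; rewrite lt0r_neq0. Qed.

(** As x is self-adjoint, <X^2 z, z> is the squared norm of X z, so the new form is expressed in the
    quantities of [step_bounds]. *)
Let shift_step x z : self_adjoint x -> ip (shift 1 (step x) z) z =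
  ip (shift 1 x z) z
  + tau * (ip (shift 1 s z) z - ip (shift 1 x z) (shift 1 x z)).
Proof.
move=> sx; rewrite !ipE.
have -> : ip (hmul (step x) z) z = ip (hmul x z) z + tau * (ip (hmul s z) z -
    2 * ip (hmul x z) z - ip (hmul (hmul x x) z) z).
  by rewrite !(hmul_adjr _ z) /step !ipE.
by rewrite -hmulA (hmul_sym _ _ sx) (ipC z (hmul x z)); ring.
Qed.

Let between_step x : between x -> between (step x).
Proof.
move=> [sx xab]; split.
  move=> w; rewrite hstar_adj /step !ipE -!hstar_adj ss sx hstar_mul.
  by rewrite (hmul_eql _ _ sx) (hmul_eqr _ _ sx).
move=> z; rewrite shift_step//.
have /andP[xa xb] := xab z.
have := sa z; have := sb z.
(* This is (X - a)(b - X) >= 0, that is, P^2 <= (b - a) P for P = X - a, which lies between 0 and b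
   - a. *)
have bound : ip (shift 1 x z) (shift 1 x z) <=
    (a + b) * ip (shift 1 x z) z - a * b * ip z z.
  have shE w v : ip (shift (1 - a) x w) v = ip (shift 1 x w) v - a * ip w v.
    by rewrite !ipE; ring.
  have := @shift_sqr_le _ _ (1 - a) x (b - a) sx _ _ _ z.
  rewrite !shE ![ip _ (shift (1 - a) x z)]ipC !shE (ipC z (shift 1 x z)) => h.
  suff: ip (shift 1 x z) (shift 1 x z) - a * ip (shift 1 x z) z -
     a * (ip (shift 1 x z) z - a * ip z z) <=
     (b - a) * (ip (shift 1 x z) z - a * ip z z) by nra.
  apply: h => [w||w]; first by rewrite shE subr_ge0; have /andP[] := xab w.
    by rewrite subr_ge0 (le_trans a1).
  by rewrite shE mulrBl lerB//; have /andP[] := xab w.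
(* The squared norm of b z - X z. *)
have bx : 0 <= b ^+ 2 * ip z z - 2 * b * ip (shift 1 x z) z +
    ip (shift 1 x z) (shift 1 x z).
  have := ip_ge0 (b *: z - shift 1 x z).
  rewrite ipBl !ipBr ipZl !ipZr ipZl (ipC z); move: (ip (shift 1 x z) z) => p; lra.
by move=> tb ta; apply: step_bounds => //; exact: ip_ge0.
Qed.

(** For X between a and b the operator 1/2 - tau X lies between 0 and r, since tau b = 1/2. The
    contraction factor 2 r is 1 - a / b. *)
Let r : R := 2^-1 - tau * a.

Let r_ge0 : 0 <= r.
Proof. by rewrite subr_ge0 -tau2b ler_pM2l// (le_trans a1). Qed.

Let r_lt1 : (2 * r) ^+ 2 < 1.
Proof.
have : 0 < tau * a by rewrite mulr_gt0.
by move: r_ge0; rewrite /r; move: (tau * a) => u ? ?; nra.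
Qed.

Let half_norm y z : between y ->
  ip (shift (2^-1 - tau) (- tau *: y) z) (shift (2^-1 - tau) (- tau *: y) z)
    <= r ^+ 2 * ip z z.
Proof.
move=> [sy yab].
have shE w v : ip (shift (2^-1 - tau) (- tau *: y) w) v =
    2^-1 * ip w v - tau * ip (shift 1 y w) v.
  by rewrite !ipDl !ipZl hmulZl; ring.
apply: shift_norm_le => //.
- by move=> v; rewrite hstar_adj !ipZl -hstar_adj sy.
- move=> v; rewrite shE subr_ge0 -tau2b -mulrA ler_pM2l//.
  by have /andP[] := yab v.
- move=> v; rewrite shE mulrBl lerB// -mulrA ler_pM2l//.
  by have /andP[] := yab v.
Qed.

(* step x - step y = (1/2 - tau X) D + D (1/2 - tau Y) with D = x - y, X = 1 + x
   and Y = 1 + y. *)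
Let step_contract x y : between x -> between y ->
  ip (step x - step y) (step x - step y) <= (2 * r) ^+ 2 * ip (x - y) (x - y).
Proof.
move=> bx [sy yab]; set D := x - y.
have xD w : ip (hmul x D) w = ip (hmul x x) w - ip (hmul x y) w by exact: hmulBr.
have Dy w : ip (hmul D y) w = ip (hmul x y) w - ip (hmul y y) w by exact: hmulBl.
have DE w : ip D w = ip x w - ip y w by exact: ipBl.
clearbody D.
pose u := shift (2^-1 - tau) (- tau *: x) D.
pose v := (2^-1 - tau) *: D - tau *: hmul D y.
have uv w : ip (step x - step y) w = ip (u + v) w.
  rewrite /u /v /step !(ipDl, ipNl, ipZl) hmulZl xD Dy !DE.
  by move: (tau) => t; field.
have -> : ip (step x - step y) (step x - step y) = ip (u + v) (u + v).
  by rewrite uv ipC uv.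
apply: (le_trans (ip_add_le u v)).
have hu : ip u u <= r ^+ 2 * ip D D by exact: half_norm.
(* The star preserves the norm and turns right multiplication by 1/2 - tau Y into left
   multiplication, where [half_norm] applies. *)
have hv : ip v v <= r ^+ 2 * ip D D.
  have vE w : ip (hstar v) w =
      ip (shift (2^-1 - tau) (- tau *: y) (hstar D)) w.
    rewrite hstar_adj !(ipDl, ipNl, ipZl) hmulZl -!hstar_adj hstar_mul.
    by rewrite (hmul_eql _ _ sy); ring.
  by rewrite -ip_hstar vE ipC vE -(ip_hstar D D) half_norm.
have -> : (2 * r) ^+ 2 * ip D D = 2 * (r ^+ 2 * ip D D + r ^+ 2 * ip D D) by ring.
by rewrite ler_pM2l// lerD.
Qed.

Let u n := iter n step 0.

Let between_u n : between (u n).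
Proof.
elim: n => [|n IH]; last exact: between_step.
(* The iteration starts at X = 1, and a <= 1 <= b is exactly what puts this point in the range. *)
split=> [w|z]; first by rewrite hstar_adj !ip0l.
have -> : ip (shift 1 (u 0) z) z = ip z z.
  by rewrite /u /= ipDl ipZl mul1r hmul_adjr ip0l addr0.
have z0 := ip_ge0 z.
by rewrite ler_piMl//= ler_peMl.
Qed.

Let u_geometric n : ip (u n.+1 - u n) (u n.+1 - u n) <=
  ip (u 1 - u 0) (u 1 - u 0) * ((2 * r) ^+ 2) ^+ n.
Proof.
elim: n => [|n IH]; first by rewrite expr0 mulr1.
apply: (le_trans (step_contract (between_u n.+1) (between_u n))).
by rewrite (exprS _ n) mulrCA; apply: ler_wpM2l; rewrite ?sqr_ge0.
Qed.

(** Closed half-spaces survive the limit, by Cauchy-Schwarz applied to [u n - x] and w.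
    Self-adjointness and both operator bounds of the limit are brought to this form. *)
Let limit_ge x w c :
  (forall e : R, 0 < e ->
     exists N, forall n, (N <= n)%N -> ip (u n - x) (u n - x) <= e) ->
  (forall n, c <= ip (u n) w) -> c <= ip x w.
Proof.
move=> ux cu; rewrite leNgt; apply/negP => xc.
have w1 : 0 < ip w w + 1 by rewrite ltr_wpDl// ip_ge0.
(* The summand 1 avoids division by zero when w is null, and the factor 1/2 makes the final
   inequality strict. *)
have e0 : 0 < (c - ip x w) ^+ 2 / (ip w w + 1) / 2.
  by rewrite !divr_gt0// exprn_gt0// subr_gt0.
have [N /(_ N (leqnn N)) uN] := ux _ e0.
have := ip_cauchy_schwarz (u N - x) w; apply/negP; rewrite -ltNge.
have h1 : (c - ip x w) ^+ 2 <= ip (u N - x) w ^+ 2.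
  have cx : 0 <= c - ip x w by rewrite subr_ge0 ltW.
  have cxu : c - ip x w <= ip (u N - x) w by rewrite ipBl lerD2r.
  by rewrite lerXn2r// nnegrE (le_trans cx).
apply: (lt_le_trans _ h1); apply: (@le_lt_trans _ _
  ((c - ip x w) ^+ 2 / (ip w w + 1) / 2 * (ip w w + 1))).
  apply: ler_pM => //; [exact: ip_ge0|exact: ip_ge0|].
  by rewrite lerDl.
have -> : (c - ip x w) ^+ 2 / (ip w w + 1) / 2 * (ip w w + 1) =
    (c - ip x w) ^+ 2 / 2 by field; rewrite lt0r_neq0.
by rewrite ltr_pdivrMr// ltr_pMr ?ltr1n// exprn_gt0// subr_gt0.
Qed.

Lemma square_root_exists_bounds : exists x, [/\ self_adjoint x, nonneg 1 x &
  forall w, 2 * ip x w + ip (hmul x x) w = ip s w].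
Proof.
have r2 : 0 <= (2 * r) ^+ 2 < 1 by rewrite sqr_ge0.
have [x ux] := hcomplete r2 u_geometric.
have sx : self_adjoint x.
  move=> w.
  (* Self-adjointness as a pair of opposite inequalities, each linear in the iterate and hence
     within reach of [limit_ge]. *)
  have h1 : 0 <= ip x (hstar w - w).
    apply: limit_ge ux _ => n; rewrite ipBr -hstar_adj.
    by have [-> _] := between_u n; rewrite subrr.
  have h2 : 0 <= ip x (w - hstar w).
    apply: limit_ge ux _ => n; rewrite ipBr -hstar_adj.
    by have [-> _] := between_u n; rewrite subrr.
  apply/eqP; rewrite hstar_adj eq_le -subr_ge0 -ipBr h2.
  by rewrite -subr_ge0 -ipBr.
have bx : between x.
  split=> // z; apply/andP; split.
    rewrite ipDl ipZl mul1r hmul_adjr -lerBlDl; apply: limit_ge ux _ => n.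
    have [_ /(_ z)/andP[h _]] := between_u n.
    by move: h; rewrite ipDl ipZl mul1r hmul_adjr -lerBlDl.
  rewrite ipDl ipZl mul1r hmul_adjr -lerBrDl -lerN2 -(ipNr (hmul z _)).
  apply: limit_ge ux _ => n.
  have [_ /(_ z)/andP[_ h]] := between_u n.
  by move: h; rewrite ipDl ipZl mul1r hmul_adjr -lerBrDl ipNr lerN2.
have fix_x : ip (step x - x) (step x - x) = 0.
  apply/eqP; rewrite eq_le ip_ge0 andbT; apply/ler_addgt0Pr => e e0.
  rewrite add0r.
  (* The quarter pays for two terms and for the factor 2 of [ip_add_le]. Since [u N.+1] is
     [step (u N)], the distance from [step x] to x is split at that iterate. *)
  have e4 : 0 < e / 4 by rewrite divr_gt0.
  have [N uN] := ux _ e4.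
  have -> : step x - x = (step x - step (u N)) + (u N.+1 - x).
    by rewrite addrA subrK.
  apply: (le_trans (ip_add_le _ _)).
  have h1 := uN N (leqnn N); have h2 := uN N.+1 (leqnSn N).
  have h3 := step_contract bx (between_u N).
  have h4 : ip (x - u N) (x - u N) = ip (u N - x) (u N - x).
    by rewrite -opprB ipNl ipNr opprK.
  rewrite h4 in h3.
  have h5 : (2 * r) ^+ 2 * ip (u N - x) (u N - x) <= ip (u N - x) (u N - x).
    by rewrite ler_piMl ?ip_ge0// ltW.
  have h6 : ip (step x - step (u N)) (step x - step (u N)) +
    ip (u N.+1 - x) (u N.+1 - x) <= e / 4 + e / 4.
    by rewrite lerD// (le_trans h3)// (le_trans h5).
  apply: le_trans (_ : 2 * (e / 4 + e / 4) <= e); first by rewrite ler_pM2l.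
  by rewrite le_eqVlt; apply/orP; left; apply/eqP; field.
exists x; split=> // [z|w].
  have /andP[+ _] := bx.2 z; apply: le_trans.
  by rewrite mulr_ge0 ?ip_ge0// ltW.
have := ip_eq0l fix_x w; rewrite /step !(ipDl, ipNl, ipZl).
rewrite addrAC subrr add0r => /eqP; rewrite mulf_eq0 gt_eqF//= => /eqP.
move: (ip s w) => ? h; apply/eqP; rewrite -subr_eq0 -oppr_eq0; apply/eqP.
by rewrite -[RHS]h; ring.
Qed.

End Existence.

(** The squared operator norm of x is at most k = [hbnd V * ip x x], and k <= (1 + k)^2, so 1 + k
    serves as a bound free of square roots. *)
Lemma ip_hmul_le x z : ip (hmul x z) z <= (1 + hbnd V * ip x x) * ip z z.
Proof.
have := ip_cauchy_schwarz (hmul x z) z; have := hmul_bnd x z.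
have := ip_ge0 (hmul x z); have := ip_ge0 z; have := ip_ge0 x.
have := hbnd_ge0 V.
move: (ip x x) (ip z z) (ip (hmul x z) z) (ip (hmul x z) (hmul x z)) (hbnd V).
move=> n m p q h h0 n0 m0 q0 qle pq.
have k0 : 0 <= h * n by exact: mulr_ge0.
rewrite leNgt; apply/negP => lt.
have : p ^+ 2 <= h * n * m ^+ 2.
  by apply: (le_trans pq); rewrite expr2 mulrA ler_wpM2r// -mulrA.
move: k0 lt; move: (h * n) => k k0 lt.
have t0 : 0 <= (1 + k) * m by rewrite mulr_ge0// addr_ge0.
have : ((1 + k) * m) ^+ 2 < p ^+ 2.
  by rewrite ltrXn2r// ?nnegrE// (le_trans t0)// ltW.
have : 0 <= (1 + k + k ^+ 2) * m ^+ 2 by rewrite mulr_ge0 ?sqr_ge0 // !addr_ge0 ?sqr_ge0.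
by move: (p ^+ 2) => p2 *; lra.
Qed.

Lemma square_root_exists s c : 0 < c -> self_adjoint s ->
  (forall z, c * ip z z <= ip (shift 1 s z) z) ->
  exists x, [/\ self_adjoint x, nonneg 1 x &
    forall w, 2 * ip x w + ip (hmul x x) w = ip s w].
Proof.
move=> c0 ss sc.
(* As a <= 1, a^2 <= a <= c bounds S below. [ip_hmul_le] bounds S = 1 + s above by b, and b <=
   b^2. *)
pose a := Num.min 1 c; pose b := 2 + hbnd V * ip s s.
have a0 : 0 < a by rewrite lt_min ltr01.
have a1 : a <= 1 by rewrite ge_min lexx.
have ac : a <= c by rewrite ge_min lexx orbT.
have K0 : 0 <= hbnd V * ip s s by rewrite mulr_ge0 ?hbnd_ge0 ?ip_ge0.
apply: (@square_root_exists_bounds _ a b) => //.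
- by rewrite /b; lra.
- move=> z; apply: le_trans (sc z); rewrite ler_wpM2r ?ip_ge0//.
  by apply: le_trans ac; rewrite expr2 ger_pMr.
- move=> z; rewrite ipDl ipZl mul1r; have := ip_hmul_le s z.
  have := ip_ge0 z; rewrite /b; move: (ip z z) (hbnd V * _) K0 => n k k0 n0 h.
  nra.
Qed.

End SquareRoot.

(** * Matrices over a Hilbert algebra *)

Section Sums.
Context {R : realType} {V : hilbert_algebra R}.
Implicit Types v w : V.

Lemma ip_suml (I : finType) (F : I -> V) v : ip (\sum_i F i) v = \sum_i ip (F i) v.
Proof.
by elim/big_ind2 : _ => [|x1 x2 y1 y2 <- <-|//]; [exact: ip0l|rewrite ipDl].
Qed.

Lemma ip_sumr (I : finType) (F : I -> V) v : ip v (\sum_i F i) = \sum_i ip v (F i).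
Proof. by rewrite ipC ip_suml; apply: eq_bigr => i _; rewrite ipC. Qed.

Lemma hmul_suml (I : finType) (F : I -> V) v w :
  ip (hmul (\sum_i F i) v) w = \sum_i ip (hmul (F i) v) w.
Proof. by rewrite hmul_adjr ip_suml; apply: eq_bigr => i _; rewrite hmul_adjr. Qed.

Lemma hmul_sumr (I : finType) (F : I -> V) v w :
  ip (hmul v (\sum_i F i)) w = \sum_i ip (hmul v (F i)) w.
Proof. by rewrite hmul_adj ip_suml; apply: eq_bigr => i _; rewrite hmul_adj. Qed.

Lemma ip_sum_sqr_le (I : finType) (F : I -> V) :
  ip (\sum_i F i) (\sum_i F i) <= #|I|%:R * \sum_i ip (F i) (F i).
Proof.
rewrite ip_suml; under eq_bigr do rewrite ip_sumr.
apply: (@le_trans _ _ (\sum_i \sum_j (2^-1 * ip (F i) (F i) + 2^-1 * ip (F j) (F j)))).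
  apply: ler_sum => i _; apply: ler_sum => j _.
  by have := ip_ge0 (F i - F j); rewrite !ipE (ipC (F j) (F i)); lra.
pose n : R := #|I|%:R; pose S := \sum_i ip (F i) (F i).
have cst (c : R) : \sum_(i : I) c = n * c by rewrite sumr_const mulr_natl.
rewrite (eq_bigr (fun i => n * (2^-1 * ip (F i) (F i)) + 2^-1 * S)); last first.
  by move=> i _; rewrite big_split/= cst mulr_sumr.
rewrite big_split/= cst -mulr_sumr -mulr_sumr -/S.
by rewrite le_eqVlt; apply/orP; left; apply/eqP; field.
Qed.

End Sums.

Section MatrixAlgebra.
Context {R : realType} (V : hilbert_algebra R) (d : nat).
Local Notation M := {ffun 'I_d * 'I_d -> V}.
Implicit Types x y z w : M.

Definition mxip x y := \sum_p ip (x p) (y p).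

Definition mxmul x y : M := [ffun p => \sum_j hmul (x (p.1, j)) (y (j, p.2))].

Definition mxstar x : M := [ffun p => hstar (x (p.2, p.1))].

Lemma mxipE x y : mxip x y = \sum_i \sum_j ip (x (i, j)) (y (i, j)).
Proof. by rewrite /mxip pair_bigA; apply: eq_bigr => -[]. Qed.

Let mxipC x y : mxip x y = mxip y x.
Proof. by apply: eq_bigr => p _; rewrite ipC. Qed.

Let mxip_linl a x y z : mxip (a *: x + y) z = a * mxip x z + mxip y z.
Proof.
by rewrite mulr_sumr -big_split; apply: eq_bigr => p _; rewrite !ffunE ip_linl.
Qed.

Let mxip_ge0 x : 0 <= mxip x x.
Proof. by apply: sumr_ge0 => p _; exact: ip_ge0. Qed.

Lemma mxip_mulE x y z :
  mxip (mxmul x y) z = \sum_i \sum_k \sum_j ip (hmul (x (i, j)) (y (j, k))) (z (i, k)).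
Proof.
rewrite mxipE; apply: eq_bigr => i _; apply: eq_bigr => k _.
by rewrite ffunE ip_suml.
Qed.

Let mxmul_linl a x y z w :
  mxip (mxmul (a *: x + y) z) w = a * mxip (mxmul x z) w + mxip (mxmul y z) w.
Proof.
rewrite !mxip_mulE mulr_sumr -big_split; apply: eq_bigr => i _.
rewrite mulr_sumr -big_split; apply: eq_bigr => k _.
rewrite mulr_sumr -big_split; apply: eq_bigr => j _.
by rewrite !ffunE hmul_linl.
Qed.

Let mxmulA x y z w : mxip (mxmul x (mxmul y z)) w = mxip (mxmul (mxmul x y) z) w.
Proof.
rewrite !mxip_mulE; apply: eq_bigr => i _; apply: eq_bigr => k _.
under eq_bigr do rewrite ffunE hmul_sumr.
under [RHS]eq_bigr do rewrite ffunE hmul_suml.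
rewrite exchange_big; apply: eq_bigr => j _; apply: eq_bigr => l _.
exact: hmulA.
Qed.

Let mxmul_adj x y z : mxip (mxmul x y) z = mxip y (mxmul (mxstar x) z).
Proof.
rewrite mxipC [RHS]mxipC !mxip_mulE mxipE.
under [LHS]eq_bigr do under eq_bigr do rewrite ffunE ip_sumr.
under [LHS]eq_bigr do rewrite exchange_big.
rewrite exchange_big; apply: eq_bigr => j _.
rewrite exchange_big; apply: eq_bigr => k _; apply: eq_bigr => i _.
by rewrite ffunE ipC hmul_adj ipC.
Qed.

Let mxstar_adj x y : mxip (mxstar x) y = mxip x (mxstar y).
Proof.
rewrite !mxipE exchange_big; apply: eq_bigr => i _; apply: eq_bigr => j _.
by rewrite !ffunE hstar_adj.
Qed.

Let mxstarK x y : mxip (mxstar (mxstar x)) y = mxip x y.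
Proof. by apply: eq_bigr => -[i j] _; rewrite !ffunE hstarK. Qed.

Let mxstar_mul x y z :
  mxip (mxstar (mxmul x y)) z = mxip (mxmul (mxstar y) (mxstar x)) z.
Proof.
apply: eq_bigr => -[i j] _; rewrite !ffunE hstar_adj !ip_suml.
by apply: eq_bigr => k _; rewrite !ffunE -hstar_adj hstar_mul.
Qed.

(** The factor d is the price of bounding the squared norm of a sum of d terms. The constant enters
    only the upper bound [b] of [square_root_exists], so a crude value suffices. *)
Let mxmul_bnd x y :
  mxip (mxmul x y) (mxmul x y) <= (d%:R * hbnd V) * (mxip x x * mxip y y).
Proof.
pose X i j := ip (x (i, j)) (x (i, j)); pose Y i j := ip (y (i, j)) (y (i, j)).
have X0 i j : 0 <= X i j by exact: ip_ge0.
have Y0 i j : 0 <= Y i j by exact: ip_ge0.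
apply: (@le_trans _ _ (\sum_i \sum_k d%:R * \sum_j hbnd V * (X i j * Y j k))).
  rewrite mxipE; apply: ler_sum => i _; apply: ler_sum => k _.
  rewrite ffunE; apply: (le_trans (ip_sum_sqr_le _)).
  rewrite card_ord ler_wpM2l//; apply: ler_sum => j _; exact: hmul_bnd.
under eq_bigr do under eq_bigr do rewrite -mulr_sumr mulrA.
under eq_bigr do rewrite -mulr_sumr.
rewrite -mulr_sumr ler_wpM2l ?mulr_ge0 ?hbnd_ge0// !mxipE mulr_suml.
apply: ler_sum => i _; rewrite exchange_big mulr_suml; apply: ler_sum => j _.
rewrite -mulr_sumr ler_wpM2l// [leRHS](bigD1 j)//= lerDl.
by apply: sumr_ge0 => k _; apply: sumr_ge0 => l _; exact: Y0.
Qed.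

Let mxcomplete (u : nat -> M) (C r : R) : 0 <= r < 1 ->
  (forall n, mxip (u n.+1 - u n) (u n.+1 - u n) <= C * r ^+ n) ->
  exists x, forall e : R, 0 < e ->
    exists N, forall n, (N <= n)%N -> mxip (u n - x) (u n - x) <= e.
Proof.
move=> r01 uC.
have compE (v v' : M) p : (v - v') p = v p - v' p by rewrite !ffunE.
have /choice[x xP] p : exists v : V, forall e : R, 0 < e ->
    exists N, forall n, (N <= n)%N -> ip (u n p - v) (u n p - v) <= e.
  apply: (hcomplete (u := fun n => u n p) r01 (C := C)) => n.
  apply: le_trans (uC n); rewrite [leRHS](bigD1 p)//= compE lerDl.
  by apply: sumr_ge0 => q _; exact: ip_ge0.
exists (finfun x) => e e0.
(* Each of the d * d components gets an equal share of e; the summand 1 keeps the denominator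
   positive for d = 0. *)
have /choice[N NP] p : exists N, forall n, (N <= n)%N ->
    ip (u n p - x p) (u n p - x p) <= e / (1 + (d * d)%:R).
  by apply: xP; rewrite divr_gt0// ltr_wpDr.
exists (\max_p N p)%N => n Nn; rewrite /mxip.
apply: (@le_trans _ _ (\sum_(p : 'I_d * 'I_d) e / (1 + (d * d)%:R))).
  apply: ler_sum => p _; rewrite compE ffunE; apply: NP.
  exact: leq_trans (leq_bigmax p) Nn.
rewrite sumr_const card_prod card_ord -[leLHS]mulr_natl mulrCA ger_pMr//.
by rewrite ler_pdivrMr ?mul1r ?lerDr// ltr_wpDr.
Qed.

Definition matrix_algebra : hilbert_algebra R :=
  HilbertAlgebra mxipC mxip_linl mxip_ge0 mxmul_linl mxmulA mxmul_adj mxstar_adj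
    mxstarK mxstar_mul (mulr_ge0 (ler0n _ d) (hbnd_ge0 V)) mxmul_bnd mxcomplete.

End MatrixAlgebra.

(** * Square integrable functions and their inner product *)

Section SquareIntegrable.
Context {disp : measure_display} {X : measurableType disp} {R : realType}.
Variable mu : {measure set X -> \bar R}.
Implicit Types f g h : X -> R.

Definition sqint f : Prop :=
  measurable_fun setT f /\ (\int[mu]_x ((f x) ^+ 2)%:E < +oo)%E.

Definition l2dot f g : R := \int[mu]_x (f x * g x).

Lemma integrable_sqr f : sqint f -> mu.-integrable setT (EFin \o (fun x => f x ^+ 2)).
Proof.
move=> [mf f2]; apply/integrableP; split.
  by apply/measurable_EFinP; exact: measurable_funX.
apply: le_lt_trans f2; rewrite le_eqVlt; apply/orP; left; apply/eqP.
by apply: eq_integral => x _ /=; rewrite ger0_norm// sqr_ge0.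
Qed.

Lemma integrable_mul f g : sqint f -> sqint g ->
  mu.-integrable setT (EFin \o (fun x => f x * g x)).
Proof.
move=> sf sg.
have := integrableD measurableT (integrable_sqr sf) (integrable_sqr sg).
apply: le_integrable => //.
  by apply/measurable_EFinP; apply: measurable_funM; [exact: sf.1|exact: sg.1].
move=> x _ /=; rewrite lee_fin [leRHS]ger0_norm ?addr_ge0 ?sqr_ge0//.
rewrite ler_norml; apply/andP; split; nra.
Qed.

Lemma sqint0 : sqint (fun=> 0).
Proof.
split; first exact: measurable_cst.
by under eq_integral do rewrite expr0n; rewrite integral0.
Qed.

Lemma sqint_le f g : measurable_fun setT f -> sqint g ->
  (forall x, `|f x| <= `|g x|) -> sqint f.
Proof.
move=> mf [mg g2] fg; split => //; apply: le_lt_trans g2.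
apply: ge0_le_integral => //.
- by move=> x _; rewrite lee_fin sqr_ge0.
- by apply/measurable_EFinP; exact: measurable_funX.
- by apply/measurable_EFinP; exact: measurable_funX.
- by move=> x _; rewrite lee_fin -(real_normK (num_real (f x))) -(real_normK (num_real (g x))) lerXn2r// nnegrE.
Qed.

Lemma sqint_norm f : sqint f -> sqint (fun x => `|f x|).
Proof.
move=> sf; apply: (sqint_le _ sf) => [|x]; last by rewrite normr_id.
by apply: measurableT_comp => //; exact: sf.1.
Qed.

Lemma sqint_lin (a : R) f g : sqint f -> sqint g -> sqint (fun x => a * f x + g x).
Proof.
move=> sf sg; split.
  apply: measurable_funD; last exact: sg.1.
  by apply: measurable_funM; [exact: measurable_cst|exact: sf.1].
have /integrableP[_] := integrableD measurableT
  (integrableZl measurableT (2 * a ^+ 2) (integrable_sqr sf))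
  (integrableZl measurableT 2 (integrable_sqr sg)).
apply: le_lt_trans; apply: ge0_le_integral => //.
- by move=> x _; rewrite lee_fin sqr_ge0.
- apply/measurable_EFinP; apply: measurable_funX; apply: measurable_funD; last exact: sg.1.
  by apply: measurable_funM; [exact: measurable_cst|exact: sf.1].
- apply: measurableT_comp => //; apply: emeasurable_funD; apply: measurable_funeM;
    apply/measurable_EFinP; apply: measurable_funX; [exact: sf.1|exact: sg.1].
- move=> x _ /=; rewrite lee_fin [leRHS]ger0_norm.
    by have := sqr_ge0 (a * f x - g x); nra.
  apply: addr_ge0; last by rewrite mulr_ge0 ?sqr_ge0.
  by rewrite mulr_ge0 ?sqr_ge0// mulr_ge0 ?sqr_ge0.
Qed.

Lemma sqintD f g : sqint f -> sqint g -> sqint (fun x => f x + g x).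
Proof.
by move=> sf sg; have := sqint_lin 1 sf sg; under eq_fun do rewrite mul1r.
Qed.

Lemma sqintZ a f : sqint f -> sqint (fun x => a * f x).
Proof.
by move=> sf; have := sqint_lin a sf sqint0; under eq_fun do rewrite addr0.
Qed.

Lemma sqint_sum (I : finType) (F : I -> X -> R) :
  (forall i, sqint (F i)) -> sqint (fun x => \sum_i F i x).
Proof.
move=> sF.
suff h (r : seq I) : sqint (fun x => \sum_(i <- r) F i x) by exact: h.
elim: r => [|i r IH].
  by under eq_fun do rewrite big_nil; exact: sqint0.
by under eq_fun do rewrite big_cons; exact: sqintD.
Qed.

Lemma l2dotC f g : l2dot f g = l2dot g f.
Proof. by apply: eq_Rintegral => x _; rewrite mulrC. Qed.

Lemma l2dot_linl a f g h : sqint f -> sqint g -> sqint h ->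
  l2dot (fun x => a * f x + g x) h = a * l2dot f h + l2dot g h.
Proof.
move=> sf sg sh; rewrite /l2dot.
under eq_Rintegral do rewrite mulrDl -mulrA.
rewrite RintegralD//; last exact: integrable_mul.
  by rewrite RintegralZl//; exact: integrable_mul.
by under eq_fun do rewrite mulrA; apply: integrable_mul => //; exact: sqintZ.
Qed.

Lemma l2dot_ge0 f : 0 <= l2dot f f.
Proof. by apply: Rintegral_ge0 => x _; rewrite -expr2 sqr_ge0. Qed.

Lemma l2dotE f : sqint f -> (\int[mu]_x ((f x) ^+ 2)%:E)%E = (l2dot f f)%:E.
Proof.
move=> sf; rewrite /l2dot /Rintegral fineK.
  by apply: eq_integral => x _; rewrite expr2.
apply: integrable_fin_num => //; exact: integrable_mul.
Qed.

Lemma ae_eq_Rintegral f g : measurable_fun setT f -> measurable_fun setT g ->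
  {ae mu, forall x, f x = g x} -> \int[mu]_x f x = \int[mu]_x g x.
Proof.
move=> mf mg fg; congr fine; apply: ae_eq_integral => //.
- exact/measurable_EFinP.
- exact/measurable_EFinP.
by apply: filterS fg => x -> .
Qed.

Lemma ae_eq_l2dot f g h : sqint f -> sqint g -> sqint h ->
  {ae mu, forall x, f x = g x} -> l2dot f h = l2dot g h.
Proof.
move=> [mf _] [mg _] [mh _] fg; apply: ae_eq_Rintegral.
- exact: measurable_funM.
- exact: measurable_funM.
by apply: filterS fg => x ->.
Qed.

Lemma sqint_ae f g : measurable_fun setT g -> sqint f ->
  {ae mu, forall x, f x = g x} -> sqint g.
Proof.
move=> mg [mf f2] fg; split => //; apply: le_lt_trans f2.
rewrite le_eqVlt; apply/orP; left; apply/eqP; apply: ae_eq_integral => //.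
- by apply/measurable_EFinP; exact: measurable_funX.
- by apply/measurable_EFinP; exact: measurable_funX.
by apply: filterS fg => x ->.
Qed.

Lemma l2dot_eq0 f : sqint f -> l2dot f f = 0 <-> {ae mu, forall x, f x = 0}.
Proof.
move=> sf; split=> [f0|f0].
  have := l2dotE sf; rewrite f0.
  have -> : (\int[mu]_x ((f x) ^+ 2)%:E)%E = (\int[mu]_x `|((f x) ^+ 2)%:E|)%E.
    by apply: eq_integral => x _; rewrite gee0_abs// lee_fin sqr_ge0.
  have mf2 : measurable_fun setT (fun x => ((f x) ^+ 2)%:E).
    by apply/measurable_EFinP; apply: measurable_funX; case: sf.
  move/(ae_eq_integral_abs mu measurableT mf2).
  by apply: filterS => x /(_ I)[/eqP]; rewrite sqrf_eq0 => /eqP.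
rewrite (@ae_eq_l2dot f (fun=> 0) f) //; last exact: sqint0.
by rewrite /l2dot; under eq_Rintegral do rewrite mul0r; rewrite /Rintegral integral0.
Qed.

End SquareIntegrable.

Section L2Space.
Context {disp : measure_display} {X : measurableType disp} {R : realType}.
Variables (mu : {measure set X -> \bar R}) (E : set X).

(* Square integrable functions on the whole space which vanish off E stand for
   those on E: no restricted measure is then needed. *)
Definition l2on : {pred X -> R} :=
  [pred f : X -> R | `[< sqint mu f /\ forall x, ~ E x -> f x = 0 >]].

Lemma l2on_submod : submod_closed l2on.
Proof.
split.
  by apply/asboolP; split; [exact: sqint0|].
move=> a f g /asboolP[sf f0] /asboolP[sg g0]; apply/asboolP; split.
  exact: sqint_lin.
by move=> x Ex; rewrite /= !fctE f0// g0// addr0 scaler0.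
Qed.

Record L2 := MkL2 { L2fun :> X -> R ; _ : L2fun \in l2on }.

HB.instance Definition _ := [isSub for L2fun].
HB.instance Definition _ := [Choice of L2 by <:].
HB.instance Definition _ := GRing.isSubmodClosed.Build R (X -> R) l2on l2on_submod.
HB.instance Definition _ := [SubChoice_isSubLmodule of L2 by <:].

Lemma L2_sqint (f : L2) : sqint mu f.
Proof. by have /asboolP[] := valP f. Qed.

Lemma L2_out (f : L2) x : ~ E x -> f x = 0.
Proof. by have /asboolP[_] := valP f; exact. Qed.

Definition mkL2 f (sf : sqint mu f) (f0 : forall x, ~ E x -> f x = 0) : L2 :=
  MkL2 (asboolT (conj sf f0)).

End L2Space.

(** * Completeness of L2 for sequences with geometric increments *)

Section GeometricConvergence.
Context {R : realType}.

Lemma geometric_cvg (v : nat -> R) (g q : R) : 0 <= q < 1 ->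
  (forall n, `|v n.+1 - v n| <= g * q ^+ n) ->
  cvgn v /\ forall n, `|v n - limn v| <= g * q ^+ n / (1 - q).
Proof.
move=> /andP[q0 q1] vq.
have q1' : 0 < 1 - q by rewrite subr_gt0.
have g0 : 0 <= g by have := vq 0; rewrite expr0 mulr1; exact: le_trans.
(* The exact partial geometric sum, with its factor 1 - q^m, is what lets the induction on m close;
   the factor is dropped afterwards. *)
have step m n : `|v (n + m)%N - v n| <= g * q ^+ n / (1 - q) * (1 - q ^+ m).
  elim: m => [|m IH]; first by rewrite addn0 subrr normr0 expr0 subrr mulr0.
  have -> : v (n + m.+1)%N - v n = (v (n + m).+1 - v (n + m)%N) + (v (n + m)%N - v n).
    by rewrite addnS addrA subrK.
  apply: (le_trans (ler_normD _ _)); apply: (le_trans (lerD (vq _) IH)).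
  rewrite le_eqVlt; apply/orP; left; apply/eqP.
  by rewrite exprD exprS; field; rewrite lt0r_neq0.
have bound n m : (n <= m)%N -> `|v n - v m| <= g * q ^+ n / (1 - q).
  move=> /subnKC <-; rewrite distrC; apply: (le_trans (step _ _)).
  by rewrite ler_piMr ?divr_ge0 ?mulr_ge0 ?exprn_ge0 ?gerBl ?exprn_ge0// ltW.
have cv : cvgn v.
  apply/cauchy_cvgP/cauchy_exP => e e0.
  have /cvgrPdist_lt/(_ e e0) [n _ nP] : geometric (g / (1 - q)) q @ \oo --> 0.
    by apply: cvg_geometric; rewrite ger0_norm.
  exists (v n); exists n => // m /= nm.
  rewrite /ball /=; apply: le_lt_trans (nP n (leqnn n)).
  apply: (le_trans (bound _ _ nm)).
  by rewrite /= sub0r normrN mulrAC ler_norm.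
split=> // n; rewrite ler_distlC; apply/andP; split.
  apply: limr_ge => //; exists n => // m /= nm.
  by have := bound n m nm; rewrite ler_distlC => /andP[].
apply: limr_le => //; exists n => // m /= nm.
by have := bound n m nm; rewrite ler_distlC => /andP[].
Qed.

End GeometricConvergence.

Section Completeness.
Context {disp : measure_display} {X : measurableType disp} {R : realType}.
Variables (mu : {measure set X -> \bar R}) (E : set X).
Implicit Types f g : L2 mu E.

Lemma sqint_sub f g : sqint mu (fun x => f x - g x).
Proof.
have := sqint_lin (-1) (L2_sqint g) (L2_sqint f).
by under eq_fun do rewrite mulN1r addrC.
Qed.

Section Cauchy.
Variables (u : nat -> L2 mu E) (C r : R).
Hypotheses (r01 : 0 <= r < 1).
Hypothesis uC : forall n, l2dot mu (u n.+1 - u n) (u n.+1 - u n) <= C * r ^+ n.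

(** What matters is r < q^2 < 1. Dividing the n-th increment by q^n leaves squared norms of ratio r
    / q^2 < 1, so the sum [G] of the weighted squares is integrable; where [G] is finite, the
    increments are at most sqrt(G) q^n pointwise. *)
Let q : R := Num.sqrt ((1 + r) / 2).

Let q2E : q ^+ 2 = (1 + r) / 2.
Proof. by rewrite sqr_sqrtr// divr_ge0// addr_ge0//; case/andP: r01. Qed.

Let q0 : 0 < q.
Proof. by rewrite sqrtr_gt0 divr_gt0// ltr_pwDl//; case/andP: r01. Qed.

Let q1 : q < 1.
Proof.
rewrite -(@ltr_pXn2r _ 2)// ?nnegrE ?ltW// q2E expr1n.
by rewrite ltr_pdivrMr// mul1r ltrD2l; case/andP: r01.
Qed.

Let rq : 0 <= r / q ^+ 2 < 1.
Proof.
case/andP: r01 => r0 r1; have q20 : 0 < q ^+ 2 by rewrite exprn_gt0.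
apply/andP; split; first by rewrite divr_ge0// ltW.
by rewrite ltr_pdivrMr// mul1r q2E ltr_pdivlMr// mulr_natr mulr2n ltrD2r.
Qed.

Let D n x := u n.+1 x - u n x.

Let G x : \bar R := (\sum_(n <oo) ((D n x / q ^+ n) ^+ 2)%:E)%E.

Let mD n : measurable_fun setT (D n).
Proof. exact: (sqint_sub _ _).1. Qed.

Let mh n : measurable_fun setT (fun x => ((D n x / q ^+ n) ^+ 2)%:E).
Proof.
apply/measurable_EFinP; apply: measurable_funX; apply: measurable_funM => //.
Qed.

Let h0 n x : (0 <= ((D n x / q ^+ n) ^+ 2)%:E)%E.
Proof. by rewrite lee_fin sqr_ge0. Qed.

Let G0 x : (0 <= G x)%E.
Proof. by apply: nneseries_ge0 => n _ _. Qed.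

Let mG : measurable_fun setT G.
Proof. exact: ge0_emeasurable_sum. Qed.

Let C0 : 0 <= C.
Proof. by have := uC 0; rewrite expr0 mulr1; apply: le_trans; exact: l2dot_ge0. Qed.

Let intG : (\int[mu]_x G x < +oo)%E.
Proof.
rewrite integral_nneseries//.
apply: (@le_lt_trans _ _ (\sum_(n <oo) (geometric C (r / q ^+ 2) n)%:E)%E).
  apply: lee_nneseries => [n _ _|n _]; first exact: integral_ge0.
  have qn : 0 <= (q ^+ n)^-1 ^+ 2 by rewrite sqr_ge0.
  under eq_integral do rewrite exprMn mulrC EFinM.
  rewrite ge0_integralZl//; last 2 first.
  - by apply/measurable_EFinP; exact: measurable_funX.
  - by move=> x _; rewrite lee_fin sqr_ge0.
  have -> : (\int[mu]_x ((D n x) ^+ 2)%:E)%E =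
    (l2dot mu (u n.+1 - u n) (u n.+1 - u n))%:E := l2dotE (L2_sqint (u n.+1 - u n)).
  rewrite -EFinM lee_fin /=; apply: (le_trans (ler_wpM2l qn (uC n))).
  rewrite le_eqVlt; apply/orP; left; apply/eqP.
  by rewrite expr_div_n exprVn -!exprM (mulnC 2) mulrCA (mulrC (r ^+ n)).
move: rq; set p := r / q ^+ 2 => /andP[p0 p1].
apply: (@le_lt_trans _ _ (C / (1 - p))%:E); last exact: ltry.
apply: lime_le.
  by apply: is_cvg_nneseries => n _ _; rewrite lee_fin mulr_ge0 ?exprn_ge0.
apply: nearW => n; rewrite sumEFin lee_fin.
have -> : \sum_(0 <= i < n) geometric C p i = series (geometric C p) n by [].
rewrite geometric_seriesE ?lt_eqF//=.
apply: ler_wpM2r; first by rewrite invr_ge0 subr_ge0 ltW.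
by rewrite ler_piMr// gerBl exprn_ge0.
Qed.

Let A : set X := [set x | (G x < +oo)%E].

Let mA : measurable A.
Proof. by rewrite -[A]setTI; apply: emeasurable_fun_infty_o. Qed.

Let aeA : {ae mu, forall x, A x}.
Proof.
have iG : mu.-integrable setT G.
  by apply/integrableP; split=> //; under eq_integral do rewrite gee0_abs//.
have := integrable_ae measurableT iG; apply: filterS => x /(_ I).
by rewrite ge0_fin_numE.
Qed.

(** Cutting off the null set where [G] is infinite makes the sequence converge at every point, so
    its limit is measurable as a pointwise limit. *)
Let v n x := u n x * \1_A x.

Let mv n : measurable_fun setT (v n).
Proof. by apply: measurable_funM; [exact: (L2_sqint (u n)).1|exact: measurable_indic]. Qed.

Let f x := limn (v ^~ x).

Let v_step x n : `|v n.+1 x - v n x| <= Num.sqrt (fine (G x)) * q ^+ n.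
Proof.
rewrite /v indicE; case: (boolP (x \in A)) => [/set_mem xA|_]; last first.
  by rewrite !mulr0 subrr normr0 mulr_ge0 ?sqrtr_ge0// exprn_ge0// ltW.
rewrite !mulr1 -ler_pdivrMr ?exprn_gt0//.
have -> : `|u n.+1 x - u n x| / q ^+ n = Num.sqrt ((D n x / q ^+ n) ^+ 2).
  by rewrite sqrtr_sqr normrM normfV (ger0_norm (exprn_ge0 n (ltW q0))).
rewrite ler_wsqrtr// -lee_fin fineK; last by rewrite ge0_fin_numE.
apply: (@le_trans _ _ (\sum_(0 <= i < n.+1) ((D i x / q ^+ i) ^+ 2)%:E)%E).
  by rewrite big_nat_recr//= leeDr// sume_ge0.
by apply: nneseries_lim_ge => i _ _.
Qed.

Let q01 : 0 <= q < 1. Proof. by rewrite ltW//=. Qed.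

Let mf : measurable_fun setT f.
Proof.
apply: (measurable_fun_cvg (h := v)) => // x _.
by have [] := geometric_cvg q01 (v_step x).
Qed.

Let vf n x : `|v n x - f x| <= Num.sqrt (fine (G x)) * q ^+ n / (1 - q).
Proof. by have [_] := geometric_cvg q01 (v_step x). Qed.

Let K : R := fine (\int[mu]_x G x) / (1 - q) ^+ 2.

(** The squared pointwise rate is a multiple of [G]; integrating it gives convergence in L2 with an
    explicit geometric rate. *)
Let intvf n : (\int[mu]_x ((v n x - f x) ^+ 2)%:E <= (K * (q ^+ 2) ^+ n)%:E)%E.
Proof.
have k0 : 0 <= (q ^+ n / (1 - q)) ^+ 2 by rewrite sqr_ge0.
have -> : (K * (q ^+ 2) ^+ n)%:E = (\int[mu]_x (((q ^+ n / (1 - q)) ^+ 2)%:E * G x))%E.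
  rewrite ge0_integralZl// -[X in (_ * X)%E]fineK -?EFinM; last first.
    by rewrite ge0_fin_numE// integral_ge0.
  congr EFin; rewrite /K expr_div_n -!exprM (mulnC 2).
  by move: (_ ^+ (n * 2)) ((1 - q) ^- 2) (fine _) => a b c; ring.
apply: ge0_le_integral => //.
- by move=> x _; rewrite lee_fin sqr_ge0.
- by apply/measurable_EFinP; apply: measurable_funX; exact: measurable_funB.
- exact: measurable_funeM.
move=> x _; apply: (@le_trans _ _ ((q ^+ n / (1 - q)) ^+ 2 * fine (G x))%:E).
  rewrite lee_fin -(real_normK (num_real (v n x - f x))).
  apply: (@le_trans _ _ ((Num.sqrt (fine (G x)) * q ^+ n / (1 - q)) ^+ 2)).
    by rewrite lerXn2r// nnegrE// (le_trans _ (vf n x)).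
  by rewrite -mulrA exprMn sqr_sqrtr ?fine_ge0// mulrC.
rewrite EFinM lee_wpmul2l//; case: (G x) (G0 x) => //= *; exact: leey.
Qed.

Let sqint_vf n : sqint mu (fun x => v n x - f x).
Proof.
split; first exact: measurable_funB.
by apply: (le_lt_trans (intvf n)); exact: ltry.
Qed.

Let vu n : {ae mu, forall x, u n x = v n x}.
Proof. by apply: filterS aeA => x xA; rewrite /v indicE mem_set// mulr1. Qed.

Let sf : sqint mu f.
Proof.
have sv : sqint mu (v 0) by apply: sqint_ae (mv 0) (L2_sqint (u 0)) (vu 0).
have := sqint_lin (-1) (sqint_vf 0) sv; congr (sqint mu _).
by apply/funext => x /=; rewrite mulN1r opprB subrK.
Qed.

(** Riesz-Fischer for the sequences that a contraction produces; no subsequence has to be extracted.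
    The limit vanishes off E because every term does. *)
Lemma L2_complete : exists x : L2 mu E, forall e : R, 0 < e ->
  exists N, forall n, (N <= n)%N -> l2dot mu (u n - x) (u n - x) <= e.
Proof.
have f0 x : ~ E x -> f x = 0.
  move=> Ex; rewrite /f (_ : v ^~ x = fun=> 0) ?lim_cst//.
  by apply/funext => n; rewrite /v L2_out// mul0r.
exists (mkL2 sf f0) => e e0.
have /cvgrPdist_le/(_ e e0) [N _ NP] : geometric K (q ^+ 2) @ \oo --> 0.
  by apply: cvg_geometric; rewrite ger0_norm ?exprn_ge0 ?ltW// exprn_ilt1// ltW.
exists N => n Nn.
have ae1 : {ae mu, forall x, (u n - mkL2 sf f0) x = v n x - f x}.
  by apply: filterS (vu n) => x <-.
have s1 := L2_sqint (u n - mkL2 sf f0).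
rewrite (ae_eq_l2dot s1 (sqint_vf n) s1 ae1) l2dotC.
rewrite (ae_eq_l2dot s1 (sqint_vf n) (sqint_vf n) ae1).
rewrite -lee_fin -l2dotE//; apply: (le_trans (intvf n)); rewrite lee_fin.
by apply: le_trans (NP n Nn); rewrite /= sub0r normrN ler_norm.
Qed.

End Cauchy.
End Completeness.

Section CauchySchwarz.
Context {disp : measure_display} {X : measurableType disp} {R : realType}.
Variable mu : {measure set X -> \bar R}.
Implicit Types f g : X -> R.

Lemma l2dot_cauchy_schwarz f g : sqint mu f -> sqint mu g ->
  l2dot mu f g ^+ 2 <= l2dot mu f f * l2dot mu g g.
Proof.
move=> sf sg; apply: discriminant_le; first exact: l2dot_ge0.
move=> t; have := l2dot_ge0 mu (fun x => t * g x + f x).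
have s := sqint_lin t sg sf.
rewrite l2dot_linl// !(l2dotC _ _ (fun x => t * g x + f x)) !l2dot_linl//.
by rewrite (l2dotC _ g f) => /le_trans; apply; rewrite le_eqVlt; apply/orP;
  left; apply/eqP; ring.
Qed.

Lemma l2dot0r f : l2dot mu f (fun=> 0) = 0.
Proof.
by rewrite /l2dot; under eq_Rintegral do rewrite mulr0; rewrite /Rintegral integral0.
Qed.

(* No integrability is assumed: l2dot is a junk value if the product is not
   integrable, but then the right-hand side is infinite. *)
Lemma le_l2dot_sqr f g : measurable_fun setT f -> measurable_fun setT g ->
  ((l2dot mu f g ^+ 2)%:E <=
    (\int[mu]_x ((f x) ^+ 2)%:E) * (\int[mu]_x ((g x) ^+ 2)%:E))%E.
Proof.
have ge0 h : (0 <= \int[mu]_x ((h x) ^+ 2)%:E)%E.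
  by apply: integral_ge0 => x _; rewrite lee_fin sqr_ge0.
have half f' g' : measurable_fun setT f' -> measurable_fun setT g' ->
    (\int[mu]_x ((f' x) ^+ 2)%:E)%E = +oo%E ->
    ((l2dot mu f' g' ^+ 2)%:E <=
    (\int[mu]_x ((f' x) ^+ 2)%:E) * (\int[mu]_x ((g' x) ^+ 2)%:E))%E.
  (* Since 0 * +oo is 0, the case of a null g' needs its own argument: g' is then zero almost
     everywhere, and so is the pairing. *)
  move=> mf mg ->; case: (eqVneq (\int[mu]_x ((g' x) ^+ 2)%:E)%E 0%E) => [g0|gn0].
    have sg : sqint mu g' by split => //; rewrite g0.
    have gae : {ae mu, forall x, g' x = 0}.
      by apply/(l2dot_eq0 sg); apply: EFin_inj; rewrite -l2dotE.
    rewrite g0 mule0 lee_fin (_ : l2dot mu f' g' = 0) ?expr0n//.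
    rewrite -(l2dot0r f'); apply: ae_eq_Rintegral.
    - exact: measurable_funM.
    - by apply: measurable_funM => //; exact: measurable_cst.
    - by apply: filterS gae => x ->.
  by rewrite gt0_mulye ?leey// lt0e gn0 ge0.
move=> mf mg; have := leey (\int[mu]_x ((f x) ^+ 2)%:E)%E.
rewrite le_eqVlt => /orP[/eqP fy|fy]; first exact: half.
have := leey (\int[mu]_x ((g x) ^+ 2)%:E)%E.
rewrite le_eqVlt => /orP[/eqP gy|gy]; first by rewrite l2dotC muleC half.
by rewrite !l2dotE// -EFinM lee_fin l2dot_cauchy_schwarz.
Qed.

End CauchySchwarz.

(** * Kernels on a product space: Fubini, integral operators and composition *)

Section ParametricIntegral.
Context {d1 d2 : measure_display} {Y : measurableType d1} {X : measurableType d2} {R : realType}.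
Variable mu : {sigma_finite_measure set X -> \bar R}.

(** Tonelli makes the integrals of the positive and negative parts measurable in y, and [fine] is
    measurable, so sections with a non-integrable F do no harm. *)
Lemma measurable_parametric_integral (F : Y * X -> R) : measurable_fun setT F ->
  measurable_fun setT (fun y => \int[mu]_x F (y, x)).
Proof.
move=> mF; apply: (measurableT_comp (fine_measurable measurableT)).
have -> : (fun y => \int[mu]_x (F (y, x))%:E)%E =
    ((fun y => \int[mu]_x ((EFin \o F)^\+ (y, x))) \-
     (fun y => \int[mu]_x ((EFin \o F)^\- (y, x))))%E.
  apply/funext => y; rewrite [LHS]integralE; congr (_ - _)%E;
    by apply: eq_integral => x _; rewrite !unlock.
have mEF : measurable_fun setT (EFin \o F) by exact/measurable_EFinP.
apply: emeasurable_funB.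
- apply: (measurable_fun_fubini_tonelli_F ((EFin \o F)^\+)%E) => //.
  exact: measurable_funepos.
- apply: (measurable_fun_fubini_tonelli_F ((EFin \o F)^\-)%E) => //.
  exact: measurable_funeneg.
Qed.

End ParametricIntegral.

Section ProductMeasure.
Context {disp : measure_display} {X : measurableType disp} {R : realType}.
Variable mu : {sigma_finite_measure set X -> \bar R}.
Local Notation mu2 := (mu \x mu)%E.
Implicit Types (f g h k F : X * X -> R) (a b : X -> R).

Definition kswap k : X * X -> R := fun p => k (p.2, p.1).

Lemma measurable_kswap k : measurable_fun setT k -> measurable_fun setT (kswap k).
Proof. by move=> mk; apply: (measurableT_comp mk); exact: measurable_swap. Qed.

Lemma ae_prod1 (P : X -> Prop) : {ae mu, forall x, P x} -> {ae mu2, forall p, P p.1}.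
Proof.
move=> [N [mN N0 PN]]; exists (N `*` setT); split.
- exact: measurableX.
- by rewrite /= product_measure1E//= N0 mul0e.
- by move=> [t s] /= nP; split => //; exact: PN.
Qed.

Lemma ae_prod2 (P : X -> Prop) : {ae mu, forall x, P x} -> {ae mu2, forall p, P p.2}.
Proof.
move=> [N [mN N0 PN]]; exists (setT `*` N); split.
- exact: measurableX.
- by rewrite /= product_measure1E//= N0 mule0.
- by move=> [t s] /= nP; split => //; exact: PN.
Qed.

(** The inner integral is finite for almost every t only; elsewhere [fine] returns a default value,
    so the real and extended iterated integrands are compared almost everywhere. *)
Lemma Rfubini1 F : mu2.-integrable setT (EFin \o F) ->
  \int[mu2]_p F p = \int[mu]_t \int[mu]_s F (t, s).
Proof.
move=> iF; have mF : measurable_fun setT F 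
  by apply/measurable_EFinP; exact: (measurable_int mu2 iF).
rewrite /Rintegral -(integral12_prod_meas1 iF); congr fine.
apply: ae_eq_integral => //.
- exact: (measurable_fubini_F iF).
- by apply/measurable_EFinP; exact: measurable_parametric_integral.
have := ae_integrable1 iF; apply: filterS => t it _.
by rewrite fineK//; exact: integrable_fin_num.
Qed.

Lemma measurable_parametric_integral2 F : measurable_fun setT F ->
  measurable_fun setT (fun s => \int[mu]_t F (t, s)).
Proof. by move=> mF; exact: (measurable_parametric_integral mu (measurable_kswap mF)). Qed.

Lemma Rfubini2 F : mu2.-integrable setT (EFin \o F) ->
  \int[mu2]_p F p = \int[mu]_s \int[mu]_t F (t, s).
Proof.
move=> iF; have mF : measurable_fun setT F 
  by apply/measurable_EFinP; exact: (measurable_int mu2 iF).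
rewrite /Rintegral -(integral21_prod_meas1 iF); congr fine.
apply: ae_eq_integral => //.
- exact: (measurable_fubini_G iF).
- by apply/measurable_EFinP; exact: measurable_parametric_integral2.
have := ae_integrable2 iF; apply: filterS => t it _.
by rewrite fineK//; exact: integrable_fin_num.
Qed.

Lemma sqint_section1 k : sqint mu2 k -> {ae mu, forall t, sqint mu (fun s => k (t, s))}.
Proof.
move=> sk; have := ae_integrable1 (integrable_sqr sk); apply: filterS => t it.
split; first by apply: measurable_fun_pair2; exact: sk.1.
exact: (integrable_lty measurableT it).
Qed.

Lemma sqint_section2 k : sqint mu2 k -> {ae mu, forall s, sqint mu (fun t => k (t, s))}.
Proof.
move=> sk; have := ae_integrable2 (integrable_sqr sk); apply: filterS => t it.
split; first by apply: measurable_fun_pair1; exact: sk.1.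
exact: (integrable_lty measurableT it).
Qed.

Let msq F : measurable_fun setT F -> measurable_fun setT (fun p => ((F p) ^+ 2)%:E).
Proof. by move=> mF; apply/measurable_EFinP; exact: measurable_funX. Qed.

Let sq0 (T : Type) (F : T -> R) p : (0 <= ((F p) ^+ 2)%:E)%E.
Proof. by rewrite lee_fin sqr_ge0. Qed.

(** Squared norms of the rows ([A]) and of the columns ([B]) of k, kept in the extended reals
    because they may be infinite on a null set. *)
Let A k t : \bar R := (\int[mu]_s ((k (t, s)) ^+ 2)%:E)%E.
Let B k s : \bar R := (\int[mu]_t ((k (t, s)) ^+ 2)%:E)%E.

Let A0 k t : (0 <= A k t)%E. Proof. by apply: integral_ge0. Qed.
Let B0 k t : (0 <= B k t)%E. Proof. by apply: integral_ge0. Qed.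

Let mA k : measurable_fun setT k -> measurable_fun setT (A k).
Proof.
move=> mk; apply: (measurable_fun_fubini_tonelli_F (fun p => ((k p) ^+ 2)%:E)) => //.
exact: msq.
Qed.

Let mB k : measurable_fun setT k -> measurable_fun setT (B k).
Proof.
move=> mk; apply: (measurable_fun_fubini_tonelli_G (fun p => ((k p) ^+ 2)%:E)) => //.
exact: msq.
Qed.

Let intA k : sqint mu2 k -> (\int[mu]_t A k t)%E = (l2dot mu2 k k)%:E.
Proof.
move=> sk; rewrite -l2dotE// (fubini_tonelli1 (fun p => ((k p) ^+ 2)%:E)) => //.
exact: msq sk.1.
Qed.

Let intB k : sqint mu2 k -> (\int[mu]_t B k t)%E = (l2dot mu2 k k)%:E.
Proof.
move=> sk; rewrite -l2dotE// (fubini_tonelli2 (fun p => ((k p) ^+ 2)%:E)) => //.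
exact: msq sk.1.
Qed.

Lemma sqint_kswap k : sqint mu2 k -> sqint mu2 (kswap k).
Proof.
move=> sk; have mk := measurable_kswap sk.1; split => //.
rewrite (fubini_tonelli1 (fun p => ((kswap k p) ^+ 2)%:E))//.
  by rewrite -[ltLHS]/((\int[mu]_t B k t)%E) intB// ltry.
exact: msq.
Qed.

Definition app k a t : R := l2dot mu (fun s => k (t, s)) a.

Definition comp f g p : R := l2dot mu (fun u => f (p.1, u)) (fun u => g (u, p.2)).

Lemma compE f g t s : comp f g (t, s) = app f (fun u => g (u, s)) t.
Proof. by []. Qed.

Lemma measurable_app k a : measurable_fun setT k -> measurable_fun setT a ->
  measurable_fun setT (app k a).
Proof.
move=> mk ma; apply: (measurable_parametric_integral mu (F := fun p => k p * a p.2)).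
by apply: measurable_funM => //; apply: (measurableT_comp ma); exact: measurable_snd.
Qed.

Lemma sqint_app k a : sqint mu2 k -> sqint mu a -> sqint mu (app k a).
Proof.
move=> sk sa; split; first by apply: measurable_app; [exact: sk.1|exact: sa.1].
apply: (@le_lt_trans _ _ (\int[mu]_t (A k t * (l2dot mu a a)%:E))%E).
  apply: ge0_le_integral => //.
  - by apply/measurable_EFinP/measurable_funX/measurable_app; [exact: sk.1|exact: sa.1].
  - by apply: emeasurable_funM => //; exact: (mA sk.1).
  - move=> t _; rewrite -l2dotE//; apply: le_l2dot_sqr; last exact: sa.1.
    by apply: measurable_fun_pair2; exact: sk.1.
rewrite ge0_integralZr//; last 2 first.
- exact: (mA sk.1).
- by rewrite lee_fin l2dot_ge0.
by rewrite intA// -EFinM ltry.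
Qed.

Lemma measurable_comp f g : measurable_fun setT f -> measurable_fun setT g ->
  measurable_fun setT (comp f g).
Proof.
move=> mf mg; apply: (measurable_parametric_integral mu
  (F := fun q : (X * X) * X => f (q.1.1, q.2) * g (q.2, q.1.2))).
apply: measurable_funM.
  apply: (measurableT_comp mf); apply: measurable_fun_pair => //.
  by apply: measurableT_comp.
apply: (measurableT_comp mg); apply: measurable_fun_pair => //.
by apply: measurableT_comp.
Qed.

(** Pointwise Cauchy-Schwarz bounds the square at (t, s) by [A f t] times [B g s], and this product
    integrates to the product of the squared norms. *)
Let comp_sqr_le f g : sqint mu2 f -> sqint mu2 g ->
  (\int[mu2]_p ((comp f g p) ^+ 2)%:E <= (l2dot mu2 f f * l2dot mu2 g g)%:E)%E.
Proof.
move=> sf sg; have mc := measurable_comp sf.1 sg.1.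
rewrite (fubini_tonelli1 (fun p => ((comp f g p) ^+ 2)%:E))//; last exact: msq.
apply: (@le_trans _ _ (\int[mu]_t (A f t * (l2dot mu2 g g)%:E))%E).
  apply: ge0_le_integral => //.
  - by move=> t _; apply: integral_ge0.
  - apply: (measurable_fun_fubini_tonelli_F (fun p => ((comp f g p) ^+ 2)%:E)) => //.
    exact: msq.
  - by apply: emeasurable_funM => //; exact: (mA sf.1).
  - move=> t _; rewrite -(intB sg) -ge0_integralZl//; last exact: (mB sg.1).
    apply: ge0_le_integral => //.
    + by apply: (measurable_fun_pair2 t (msq mc)).
    + by apply: emeasurable_funM => //; exact: (mB sg.1).
    + move=> s _; apply: le_l2dot_sqr.
        by apply: measurable_fun_pair2; exact: sf.1.
      by apply: measurable_fun_pair1; exact: sg.1.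
rewrite ge0_integralZr//; last 2 first.
- exact: (mA sf.1).
- by rewrite lee_fin l2dot_ge0.
by rewrite intA// -EFinM.
Qed.

Lemma sqint_comp f g : sqint mu2 f -> sqint mu2 g -> sqint mu2 (comp f g).
Proof.
move=> sf sg; split; first by apply: measurable_comp; [exact: sf.1|exact: sg.1].
by apply: (le_lt_trans (comp_sqr_le sf sg)); exact: ltry.
Qed.

Lemma comp_bound f g : sqint mu2 f -> sqint mu2 g ->
  l2dot mu2 (comp f g) (comp f g) <= l2dot mu2 f f * l2dot mu2 g g.
Proof.
by move=> sf sg; rewrite -lee_fin -l2dotE; [exact: comp_sqr_le|exact: sqint_comp].
Qed.

End ProductMeasure.

Section CompositionLaws.
Context {disp : measure_display} {X : measurableType disp} {R : realType}.
Variable mu : {sigma_finite_measure set X -> \bar R}.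
Local Notation mu2 := (mu \x mu)%E.
Implicit Types (f g h k F : X * X -> R) (a b : X -> R).

Lemma sqint_tensor a b : sqint mu a -> sqint mu b ->
  sqint mu2 (fun p => a p.1 * b p.2).
Proof.
move=> sa sb.
have m : measurable_fun setT (fun p : X * X => a p.1 * b p.2).
  apply: measurable_funM.
    by apply: (measurableT_comp sa.1); exact: measurable_fst.
  by apply: (measurableT_comp sb.1); exact: measurable_snd.
split => //; rewrite (fubini_tonelli1 (fun p => ((a p.1 * b p.2) ^+ 2)%:E)); last 2 first.
- by apply/measurable_EFinP; exact: measurable_funX.
- by move=> p; rewrite lee_fin sqr_ge0.
rewrite /fubini_F /=.
have -> : (\int[mu]_x \int[mu]_y ((a x * b y) ^+ 2)%:E)%E =
    (\int[mu]_x (((a x) ^+ 2)%:E * (l2dot mu b b)%:E))%E.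
  apply: eq_integral => x _; rewrite -l2dotE// -ge0_integralZl//.
  - by apply: eq_integral => y _; rewrite exprMn EFinM.
  - by apply/measurable_EFinP; apply: measurable_funX; exact: sb.1.
  - by move=> y _; rewrite lee_fin sqr_ge0.
  - by rewrite lee_fin sqr_ge0.
rewrite ge0_integralZr//.
- by rewrite l2dotE// -EFinM ltry.
- by apply/measurable_EFinP; apply: measurable_funX; exact: sa.1.
- by move=> y _; rewrite lee_fin sqr_ge0.
- by rewrite lee_fin l2dot_ge0.
Qed.

(** Both sides are iterated integrals of a(t) b(s) k(t, s), integrable on the product as a product
    of two square integrable functions. *)
Lemma app_adj k a b : sqint mu2 k -> sqint mu a -> sqint mu b ->
  l2dot mu a (app mu k b) = l2dot mu (app mu (kswap k) a) b.
Proof.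
move=> sk sa sb; pose F p := a p.1 * b p.2 * k p.
have iF : mu2.-integrable setT (EFin \o F).
  by apply: integrable_mul => //; exact: sqint_tensor.
have mF : measurable_fun setT F.
  by apply/measurable_EFinP; exact: (measurable_int mu2 iF).
have sb' := (sqint_app sk sb).1; have sa' := (sqint_app (sqint_kswap sk) sa).1.
transitivity (\int[mu2]_p F p).
  rewrite Rfubini1//; apply: ae_eq_Rintegral.
  - by apply: measurable_funM => //; exact: sa.1.
  - exact: measurable_parametric_integral.
  have := sqint_section1 sk; apply: filterS => t st.
  rewrite /app /l2dot -RintegralZl//; last exact: integrable_mul.
  by apply: eq_Rintegral => s _; rewrite /F /=; ring.
rewrite Rfubini2//; apply: ae_eq_Rintegral.
- exact: measurable_parametric_integral2.
- by apply: measurable_funM => //; exact: sb.1.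
have := sqint_section2 sk; apply: filterS => s st.
rewrite /app /l2dot -RintegralZr//; last first.
  by apply: integrable_mul.
by apply: eq_Rintegral => t _; rewrite /F /kswap /=; ring.
Qed.

Lemma l2dot_sections2 f g : sqint mu2 f -> sqint mu2 g ->
  l2dot mu2 f g = \int[mu]_s l2dot mu (fun t => f (t, s)) (fun t => g (t, s)).
Proof. by move=> sf sg; rewrite /l2dot Rfubini2//; exact: integrable_mul. Qed.

Lemma l2dot_sections1 f g : sqint mu2 f -> sqint mu2 g ->
  l2dot mu2 f g = \int[mu]_t l2dot mu (fun s => f (t, s)) (fun s => g (t, s)).
Proof. by move=> sf sg; rewrite /l2dot Rfubini1//; exact: integrable_mul. Qed.

(** [app_adj] on almost every column: the column s of a composition is the left kernel applied to
    the column s of the right one. *)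
Lemma comp_adj f g h : sqint mu2 f -> sqint mu2 g -> sqint mu2 h ->
  l2dot mu2 (comp mu f g) h = l2dot mu2 g (comp mu (kswap f) h).
Proof.
move=> sf sg sh; have sfg := sqint_comp sf sg.
have sfh := sqint_comp (sqint_kswap sf) sh.
rewrite (l2dot_sections2 sfg sh) (l2dot_sections2 sg sfh).
apply: ae_eq_Rintegral.
- apply: (measurable_parametric_integral2 mu (F := fun p => comp mu f g p * h p)).
  by apply: measurable_funM; [exact: sfg.1|exact: sh.1].
- apply: (measurable_parametric_integral2 mu (F := fun p => g p * comp mu (kswap f) h p)).
  by apply: measurable_funM; [exact: sg.1|exact: sfh.1].
have := sqint_section2 sg; have := sqint_section2 sh; apply: filterS2 => s shs sgs.
by rewrite l2dotC (l2dotC _ (fun t => g (t, s))) -(app_adj sf shs sgs).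
Qed.

(** At (t, s) this is [app_adj] for g, between the row t of f and the column s of h, which are
    square integrable for almost every t and s. *)
Lemma comp_assoc f g h : sqint mu2 f -> sqint mu2 g -> sqint mu2 h ->
  {ae mu2, forall p, comp mu f (comp mu g h) p = comp mu (comp mu f g) h p}.
Proof.
move=> sf sg sh.
have := ae_prod1 (sqint_section1 sf); have := ae_prod2 (sqint_section2 sh).
apply: filterS2 => -[t s] /= shs sft.
rewrite [LHS](app_adj sg sft shs); apply: eq_Rintegral => v _; congr (_ * _).
exact: l2dotC.
Qed.

Lemma comp_linl (c : R) f g h : sqint mu2 f -> sqint mu2 g -> sqint mu2 h ->
  {ae mu2, forall p, comp mu (fun q => c * f q + g q) h p =
    c * comp mu f h p + comp mu g h p}.
Proof.
move=> sf sg sh.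
have := ae_prod1 (sqint_section1 sf); have := ae_prod1 (sqint_section1 sg).
have := ae_prod2 (sqint_section2 sh).
by apply: filterS3 => -[t s] /= shs sgt sft; exact: l2dot_linl.
Qed.

Lemma kswap_comp f g p : kswap (comp mu f g) p = comp mu (kswap g) (kswap f) p.
Proof. exact: l2dotC. Qed.

Lemma l2dot_kswap f g : sqint mu2 f -> sqint mu2 g ->
  l2dot mu2 (kswap f) g = l2dot mu2 f (kswap g).
Proof.
move=> sf sg; rewrite l2dot_sections1//; last exact: sqint_kswap.
by rewrite l2dot_sections2//; exact: sqint_kswap.
Qed.

End CompositionLaws.

(** * The Hilbert algebra of scalar kernels *)

Section KernelAlgebra.
Context {disp : measure_display} {X : measurableType disp} {R : realType}.
Variables (mu : {sigma_finite_measure set X -> \bar R}) (D : set X).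
Local Notation mu2 := (mu \x mu)%E.
Local Notation K := (L2 mu2 (D `*` D)).
Implicit Types x y z w : K.

Let out_comp x y p : ~ (D `*` D) p -> comp mu x y p = 0.
Proof.
move=> nD; have [D1|D1] := pselect (D p.1).
  rewrite /comp (_ : (fun u => y (u, p.2)) = fun=> 0) ?l2dot0r//.
  by apply/funext => u; apply: L2_out => -[_ ?]; apply: nD.
rewrite /comp l2dotC (_ : (fun u => x (p.1, u)) = fun=> 0) ?l2dot0r//.
by apply/funext => u; apply: L2_out => -[].
Qed.

Let out_swap x p : ~ (D `*` D) p -> kswap x p = 0.
Proof. by move=> nD; apply: L2_out => -[? ?]; apply: nD. Qed.

Let kmul x y : K := mkL2 (sqint_comp (L2_sqint x) (L2_sqint y)) (@out_comp x y).

Let kstar x : K := mkL2 (sqint_kswap (L2_sqint x)) (@out_swap x).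

Let kip x y := l2dot mu2 x y.

Let kip_linl (a : R) x y z : kip (a *: x + y) z = a * kip x z + kip y z.
Proof. exact: (l2dot_linl a (L2_sqint x) (L2_sqint y) (L2_sqint z)). Qed.

Let kmul_linl (a : R) x y z w :
  kip (kmul (a *: x + y) z) w = a * kip (kmul x z) w + kip (kmul y z) w.
Proof.
rewrite -kip_linl; apply: ae_eq_l2dot; [exact: L2_sqint..|].
exact: (comp_linl a (L2_sqint x) (L2_sqint y) (L2_sqint z)).
Qed.

Let kmulA x y z w : kip (kmul x (kmul y z)) w = kip (kmul (kmul x y) z) w.
Proof.
apply: ae_eq_l2dot; [exact: L2_sqint..|].
by apply: comp_assoc; exact: L2_sqint.
Qed.

Let kmul_adj x y z : kip (kmul x y) z = kip y (kmul (kstar x) z).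
Proof. by apply: comp_adj; exact: L2_sqint. Qed.

Let kstar_adj x y : kip (kstar x) y = kip x (kstar y).
Proof. by apply: l2dot_kswap; exact: L2_sqint. Qed.

Let kstarK x y : kip (kstar (kstar x)) y = kip x y.
Proof. by apply: eq_Rintegral => -[]. Qed.

Let kstar_mul x y z : kip (kstar (kmul x y)) z = kip (kmul (kstar y) (kstar x)) z.
Proof. by apply: eq_Rintegral => p _; congr (_ * _); exact: kswap_comp. Qed.

Let kmul_bnd x y : kip (kmul x y) (kmul x y) <= 1 * (kip x x * kip y y).
Proof. by rewrite mul1r; apply: comp_bound; exact: L2_sqint. Qed.

Definition kernel_algebra : hilbert_algebra R :=
  @HilbertAlgebra R K kip kmul kstar 1 (fun x y => l2dotC mu2 x y) kip_linl
    (fun x => l2dot_ge0 mu2 x) kmul_linl kmulA kmul_adj kstar_adj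
    kstarK kstar_mul ler01 kmul_bnd (fun u C r => @L2_complete _ _ _ mu2 _ u C r).

End KernelAlgebra.

Section AlmostEverywhere.
Context {disp : measure_display} {X : measurableType disp} {R : realType}.
Variable mu : {measure set X -> \bar R}.
Implicit Types P Q S : X -> Prop.

Lemma ae_mono P Q : (forall x, P x -> Q x) ->
  {ae mu, forall x, P x} -> {ae mu, forall x, Q x}.
Proof. by move=> PQ; apply: filterS. Qed.

Lemma ae_mono2 P Q S : (forall x, P x -> Q x -> S x) ->
  {ae mu, forall x, P x} -> {ae mu, forall x, Q x} -> {ae mu, forall x, S x}.
Proof. by move=> PQS; apply: filterS2. Qed.

Lemma ae_forall (I : finType) (P : I -> X -> Prop) :
  (forall i, {ae mu, forall x, P i x}) -> {ae mu, forall x, forall i, P i x}.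
Proof. exact: filter_forall. Qed.

End AlmostEverywhere.

(** * Passage between matrix-valued kernels and the algebra *)

Section Entries.
Context {disp : measure_display} {X : measurableType disp} {R : realType}.
Variables (nu : {measure set X -> \bar R}) (D : set X) (m n : nat).
Hypothesis mD : measurable D.
Implicit Types F G : X -> 'M[R]_(m, n).

Definition entry F i j : X -> R := (fun x => F x i j) \_ D.

Lemma entry_in F i j x : D x -> entry F i j x = F x i j.
Proof. by move=> Dx; rewrite /entry patchT// inE. Qed.

Lemma entry_out F i j x : ~ D x -> entry F i j x = 0.
Proof. by move=> Dx; rewrite /entry patchC// inE. Qed.

Lemma enorm_sqr p q (A : 'M[R]_(p, q)) : enorm A ^+ 2 = \sum_i \sum_j A i j ^+ 2.
Proof.
by rewrite sqr_sqrtr//; do 2 apply: sumr_ge0 => ? _; exact: sqr_ge0.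
Qed.

Lemma measurable_entry F i j :
  measurable_fun D (fun x => F x i j) <-> measurable_fun setT (entry F i j).
Proof. exact: measurable_restrictT. Qed.

Let sq0 (f : X -> R) x : (0 <= ((f x) ^+ 2)%:E)%E.
Proof. by rewrite lee_fin sqr_ge0. Qed.

Lemma integral_enorm F : (forall i j, measurable_fun D (fun x => F x i j)) ->
  (\int[nu]_(x in D) ((enorm (F x)) ^+ 2)%:E =
   \sum_i \sum_j \int[nu]_x ((entry F i j x) ^+ 2)%:E)%E.
Proof.
move=> mF.
have mf2 i j : measurable_fun setT (fun x => ((entry F i j x) ^+ 2)%:E).
  by apply/measurable_EFinP; apply: measurable_funX; apply/measurable_entry.
transitivity (\int[nu]_x (\sum_i \sum_j ((entry F i j x) ^+ 2)%:E))%E.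
  rewrite integral_mkcond; apply: eq_integral => x _; rewrite patchE.
  case: ifPn => [/set_mem Dx|/negP nD].
    rewrite enorm_sqr -sumEFin; apply: eq_bigr => i _; rewrite -sumEFin.
    by apply: eq_bigr => j _; rewrite entry_in.
  have {}nD : ~ D x by move=> Dx; apply: nD; rewrite inE.
  by rewrite big1 // => i _; rewrite big1// => j _; rewrite entry_out// expr0n.
rewrite ge0_integral_sum//.
- apply: eq_bigr => i _; rewrite ge0_integral_sum//.
- by move=> i; apply: emeasurable_sum => j; exact: mf2.
- by move=> i x _; apply: sume_ge0.
Qed.

Lemma square_integrableP F : square_integrable nu D F <->
  forall i j, sqint nu (entry F i j).
Proof.
have mP : (forall i j, measurable_fun D (fun x => F x i j)) <->
    (forall i j, measurable_fun setT (entry F i j)).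
  by split=> h i j; apply/measurable_entry.
have sqrteP (x : \bar R) : (0 <= x)%E -> (sqrte x < +oo)%E = (x < +oo)%E.
  by case: x => [r||]//= _; rewrite !ltry.
split=> [[mF]|sF].
  rewrite /L2norm sqrteP; last by apply: integral_ge0 => ? _; rewrite lee_fin sqr_ge0.
  rewrite integral_enorm// => sF i j; split; first by move/mP: mF.
  apply: le_lt_trans sF; rewrite (bigD1 i)//= (bigD1 j)//= -addeA leeDl//.
  rewrite adde_ge0//; first by apply: sume_ge0 => ? _; apply: integral_ge0.
  by apply: sume_ge0 => ? _; apply: sume_ge0 => ? _; apply: integral_ge0.
have mF i j : measurable_fun D (fun x => F x i j).
  by apply/measurable_entry; case: (sF i j).
split => //; rewrite /L2norm sqrteP; last by apply: integral_ge0 => ? _; rewrite lee_fin sqr_ge0.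
rewrite integral_enorm//; apply: lte_sum_pinfty => i _.
by apply: lte_sum_pinfty => j _; case: (sF i j).
Qed.

Lemma entryB F G i j : entry (fun x => F x - G x) i j =
  (fun x => entry F i j x - entry G i j x).
Proof.
apply/funext => x; have [Dx|nD] := pselect (D x).
  by rewrite !entry_in// !mxE.
by rewrite !entry_out// subrr.
Qed.

Lemma L2eqP F G : square_integrable nu D F -> square_integrable nu D G ->
  L2eq nu D F G <-> forall i j, {ae nu, forall x, entry F i j x = entry G i j x}.
Proof.
move=> sF sG.
have sB i j : sqint nu (entry (fun x => F x - G x) i j).
  rewrite entryB; have /square_integrableP/(_ i j) sf := sF.
  have /square_integrableP/(_ i j) sg := sG.
  by have := sqint_lin (-1) sg sf; under eq_fun do rewrite mulN1r addrC.
have mB : forall i j, measurable_fun D (fun x => (F x - G x) i j).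
  by move=> i j; apply/measurable_entry; case: (sB i j).
have I0 i j : (0 <= \int[nu]_x ((entry (fun x => F x - G x) i j x) ^+ 2)%:E)%E.
  exact: integral_ge0.
have aeP i j : {ae nu, forall x, entry (fun x => F x - G x) i j x = 0} <->
    {ae nu, forall x, entry F i j x = entry G i j x}.
  by split; apply: filterS => x; rewrite entryB; [move/subr0_eq|move=> ->; rewrite subrr].
rewrite /L2eq /L2norm integral_enorm//; split=> [h i j|h].
  apply/aeP/(l2dot_eq0 (sB i j)); apply: EFin_inj; rewrite -l2dotE//.
  have s0 : (\sum_i \sum_j \int[nu]_x ((entry (fun x => F x - G x) i j x) ^+ 2)%:E = 0)%E.
    have /sqr_sqrte <- : (0 <= \sum_i \sum_j
      \int[nu]_x ((entry (fun x => F x - G x) i j x) ^+ 2)%:E)%E.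
      by do 2 apply: sume_ge0 => ? _.
    by rewrite h expe2 mule0.
  apply/eqP; rewrite eq_le I0 andbT; rewrite -[leRHS]s0.
  rewrite (bigD1 i)//= (bigD1 j)//= -addeA leeDl//.
  by rewrite adde_ge0//; do ?[apply: sume_ge0 => ? _].
rewrite big1 ?sqrte0// => i _; rewrite big1// => j _.
by rewrite l2dotE//; congr EFin; apply/l2dot_eq0 => //; apply/aeP.
Qed.

End Entries.

Section KernelEmbedding.
Context {R : realType} (T : R) (d : nat).
Local Notation mu := (@lebesgue_measure R).
Local Notation mu2 := (mu \x mu)%E.
Local Notation I := (`[0, T]%classic : set R).
Local Notation square := (I `*` I).
Local Notation kernel := (R * R -> 'M[R]_d).

Definition kernel_matrices : hilbert_algebra R :=
  matrix_algebra (kernel_algebra mu I) d.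
Local Notation M := kernel_matrices.
Implicit Types (k : kernel) (x y z : M).

Lemma measurable_square : measurable square.
Proof. exact: measurableX. Qed.

(* Outside L2 this is the zero matrix. *)
Definition emb k : M :=
  [ffun p : 'I_d * 'I_d => insubd (0 : L2 mu2 square) (entry square k p.1 p.2)].

Definition comp_of x i j : L2 mu2 square := (x : {ffun _ -> L2 mu2 square}) (i, j).

Lemma comp_out x i j p : ~ square p -> comp_of x i j p = 0.
Proof. exact: (@L2_out _ _ _ mu2 square (comp_of x i j) p). Qed.

Lemma comp_sqint x i j : sqint mu2 (comp_of x i j).
Proof. exact: L2_sqint. Qed.

Lemma kernel_L2P k : kernel_L2 T k <-> forall i j, sqint mu2 (entry square k i j).
Proof. exact: (square_integrableP mu2 measurable_square k). Qed.

Lemma comp_emb k i j : kernel_L2 T k ->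
  comp_of (emb k) i j = entry square k i j :> (R * R -> R).
Proof.
move=> /kernel_L2P sk; rewrite /comp_of ffunE.
suff h : entry square k i j \in l2on mu2 square by rewrite insubdK.
by apply/asboolP; split; [exact: sk|move=> p; exact: entry_out].
Qed.

Definition unemb x : kernel := fun q => \matrix_(i, j) comp_of x i j q.

Lemma entry_unemb x i j : entry square (unemb x) i j = comp_of x i j.
Proof.
apply/funext => q; have [Dq|nD] := pselect (square q).
  by rewrite entry_in// mxE.
by rewrite entry_out// comp_out.
Qed.

Lemma unemb_L2 x : kernel_L2 T (unemb x).
Proof. by apply/kernel_L2P => i j; rewrite entry_unemb; exact: comp_sqint. Qed.

Lemma comp_eq x y : (forall i j, comp_of x i j = comp_of y i j :> (R * R -> R)) -> x = y.
Proof.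
by move=> xy; apply/ffunP => -[i j]; apply: val_inj; exact: xy.
Qed.

Lemma emb_unemb x : emb (unemb x) = x.
Proof.
apply: comp_eq => i j; rewrite comp_emb; last exact: unemb_L2.
exact: entry_unemb.
Qed.

Lemma ip_comp x y :
  ip x y = \sum_i \sum_j l2dot mu2 (comp_of x i j) (comp_of y i j).
Proof. exact: mxipE. Qed.

(** Testing with z = x - y gives norm zero, and a sum of squared component norms vanishes only if
    every component does. *)
Lemma ip_eqP x y : (forall z, ip x z = ip y z) <->
  forall i j, {ae mu2, forall q, comp_of x i j q = comp_of y i j q}.
Proof.
split=> [xy i j|xy z].
  have : ip (x - y) (x - y) = 0 by rewrite ipBl xy subrr.
  rewrite ip_comp => /eqP; rewrite psumr_eq0; last first.
    by move=> ? _; apply: sumr_ge0 => ? _; exact: l2dot_ge0.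
  move/allP => /(_ i (mem_index_enum i)); rewrite psumr_eq0; last first.
    by move=> ? _; exact: l2dot_ge0.
  move/allP => /(_ j (mem_index_enum j))/eqP.
  move/(l2dot_eq0 (comp_sqint _ _ _)); apply: ae_mono => q.
  by rewrite /comp_of !ffunE /= => /subr0_eq.
rewrite !ip_comp; apply: eq_bigr => i _; apply: eq_bigr => j _.
by apply: ae_eq_l2dot; [exact: comp_sqint..|exact: xy].
Qed.

Lemma kernel_eqP k k' : kernel_L2 T k -> kernel_L2 T k' ->
  kernel_eq T k k' <-> forall z, ip (emb k) z = ip (emb k') z.
Proof.
move=> hk hk'; have eqP := @L2eqP _ _ _ mu2 square d d measurable_square k k' hk hk'.
split=> [/eqP h|/ip_eqP h].
  by apply/ip_eqP => i j; have := h i j; rewrite !comp_emb.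
by apply/eqP => i j; have := h i j; rewrite !comp_emb.
Qed.

Lemma kernel_S2P k : kernel_L2 T k -> kernel_S2 T k <-> self_adjoint (emb k).
Proof.
move=> hk; apply: (@iff_trans _ (forall i j,
    {ae mu2, forall q, entry square k j i (q.2, q.1) = entry square k i j q})).
  split=> [[_ h] i j|h].
    apply: ae_mono h => -[t s] kq.
    have [[ti si]|nq] := pselect (square (t, s)).
      have /(congr1 (fun A : 'M[R]_d => A j i)) := kq (conj ti si); rewrite mxE /= => kE.
      by rewrite !entry_in.
    by rewrite !entry_out// => -[? ?]; apply: nq.
  split=> //; have := ae_forall (fun i => ae_forall (h i)).
  apply: ae_mono => -[t s] kq [ti si]; apply/matrixP => i j; rewrite mxE.
  by have := kq j i; rewrite !entry_in.
apply: (@iff_trans _ (forall i j, {ae mu2, forall q,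
    comp_of (hstar (emb k)) i j q = comp_of (emb k) i j q})).
  by split=> h i j; have := h i j; apply: ae_mono => q; rewrite !comp_emb //
    /comp_of ffunE /= -/(comp_of (emb k) j i) /kswap comp_emb.
exact: iff_sym (ip_eqP _ _).
Qed.

End KernelEmbedding.

Section FiniteSums.
Context {disp : measure_display} {X : measurableType disp} {R : realType}.
Variable mu : {measure set X -> \bar R}.

Let finsum (I : finType) (F : I -> X -> R) (r : seq I) :
  (forall i, mu.-integrable setT (EFin \o F i)) ->
  mu.-integrable setT (EFin \o (fun x => \sum_(i <- r) F i x)) /\
    \int[mu]_x (\sum_(i <- r) F i x) = \sum_(i <- r) \int[mu]_x F i x.
Proof.
move=> iF; elim: r => [|i r [IH1 IH2]].
  split; first by under eq_fun do rewrite big_nil; exact: integrable0.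
  by rewrite big_nil; under eq_Rintegral do rewrite big_nil; rewrite /Rintegral integral0.
split.
  under eq_fun do rewrite big_cons.
  by apply: eq_integrable (integrableD measurableT (iF i) IH1).
by rewrite big_cons -IH2; under eq_Rintegral do rewrite big_cons; rewrite RintegralD.
Qed.

Lemma integrable_finsum (I : finType) (F : I -> X -> R) :
  (forall i, mu.-integrable setT (EFin \o F i)) ->
  mu.-integrable setT (EFin \o (fun x => \sum_i F i x)).
Proof. by move=> iF; have [] := finsum (index_enum I) iF. Qed.

Lemma Rintegral_sum (I : finType) (F : I -> X -> R) :
  (forall i, mu.-integrable setT (EFin \o F i)) ->
  \int[mu]_x (\sum_i F i x) = \sum_i \int[mu]_x F i x.
Proof. by move=> iF; have [] := finsum (index_enum I) iF. Qed.

Lemma L2_sumE (E : set X) (I : finType) (F : I -> L2 mu E) x :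
  (\sum_i F i) x = \sum_i F i x.
Proof. by apply: (big_morph (fun f : L2 mu E => f x)). Qed.

End FiniteSums.

(** * The map eta inside the algebra *)

Section Eta.
Context {R : realType} (T : R) (d : nat).
Local Notation mu := (@lebesgue_measure R).
Local Notation mu2 := (mu \x mu)%E.
Local Notation I := (`[0, T]%classic : set R).
Local Notation square := (I `*` I).
Local Notation M := (kernel_matrices T d).
Implicit Types k : R * R -> 'M[R]_d.

(** Completing the square, 1 - [eta_alg x] is the product of the adjoint of 1 + x with 1 + x. *)
Definition eta_alg (x : M) : M := - (x + hstar x + hmul (hstar x) x).

Lemma comp_eta_alg (x : M) i j p : comp_of (eta_alg x) i j p =
  - (comp_of x i j p + comp_of x j i (p.2, p.1) +
     \sum_l comp mu (kswap (comp_of x l i)) (comp_of x l j) p).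
Proof.
rewrite /comp_of !ffunE; congr (- (_ + _ + _)).
apply: (etrans (@L2_sumE _ _ _ mu2 square _ _ p)).
by apply: eq_bigr => l _; rewrite ffunE.
Qed.

Lemma entry_eta k i j : kernel_L2 T k ->
  entry square (eta_of T k) i j = (fun p : R * R =>
  - (comp_of (emb T k) i j p + comp_of (emb T k) j i (p.2, p.1) +
     \int[mu]_u \sum_l comp_of (emb T k) l i (u, p.1) * comp_of (emb T k) l j (u, p.2))).
Proof.
move=> hk; apply/funext => -[t s].
have [[It Is]|nts] := pselect (square (t, s)).
  rewrite entry_in// !mxE !comp_emb// !entry_in//; congr (- (_ + _ + _)).
  rewrite Rintegral_mkcond; apply: eq_Rintegral => u _; rewrite patchE.
  case: ifPn => [/set_mem Iu|nIu].
    rewrite !mxE; apply: eq_bigr => l _.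
    by rewrite !comp_emb// !entry_in// mxE.
  rewrite big1// => l _; rewrite comp_out ?mul0r// => -[/= Iu _].
  by move: nIu; rewrite mem_set.
rewrite entry_out// !comp_out//=; last by move=> -[? ?]; apply: nts.
rewrite (@eq_Rintegral _ _ _ _ _ (fun=> 0)) ?/Rintegral ?integral0 ?addr0 ?oppr0//.
move=> u _; rewrite big1// => l _; have [It|nt] := pselect (I t).
  by rewrite [X in _ * X]comp_out ?mulr0// => -[_ /= Is]; apply: nts.
by rewrite comp_out ?mul0r// => -[_ /= It].
Qed.

(** The entries of [eta_of] integrate a sum over l, those of the algebra sum d integrals. The two
    agree wherever the columns involved are square integrable, that is, almost everywhere. *)
Lemma entry_eta_ae k i j : kernel_L2 T k ->
  {ae mu2, forall p, comp_of (eta_alg (emb T k)) i j p = entry square (eta_of T k) i j p}.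
Proof.
move=> hk; rewrite entry_eta//.
have sec l m : {ae mu, forall t, sqint mu (fun u => comp_of (emb T k) l m (u, t))}.
  exact: (@sqint_section2 _ _ _ mu _ (comp_sqint (emb T k) l m)).
have /(@ae_prod1 _ _ _ mu) h1 := ae_forall (fun l => sec l i).
have /(@ae_prod2 _ _ _ mu) h2 := ae_forall (fun l => sec l j).
apply: ae_mono2 h1 h2 => -[t s] /= h1 h2.
rewrite comp_eta_alg; congr (- (_ + _)).
by rewrite Rintegral_sum// => l; exact: integrable_mul.
Qed.

(** Finiteness of the norm is transported from the algebra by almost everywhere equality;
    measurability does not travel that way and is proved directly. *)
Lemma eta_sqint k i j : kernel_L2 T k -> sqint mu2 (entry square (eta_of T k) i j).
Proof.
move=> hk; apply: (@sqint_ae _ _ _ mu2 _ _ _ (comp_sqint (eta_alg (emb T k)) i j)).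
  rewrite entry_eta//; apply: measurableT_comp => //; apply: measurable_funD.
    apply: measurable_funD; first exact: (comp_sqint _ _ _).1.
    exact: (measurable_kswap (comp_sqint _ _ _).1).
  apply: (measurable_parametric_integral mu (F := fun q : (R * R) * R =>
    \sum_l comp_of (emb T k) l i (q.2, q.1.1) * comp_of (emb T k) l j (q.2, q.1.2))).
  apply: measurable_sum => l; apply: measurable_funM.
    apply: (measurableT_comp (comp_sqint _ _ _).1); apply: measurable_fun_pair => //.
    by apply: measurableT_comp.
  apply: (measurableT_comp (comp_sqint _ _ _).1); apply: measurable_fun_pair => //.
  by apply: measurableT_comp.
exact: entry_eta_ae.
Qed.

Lemma eta_L2 k : kernel_L2 T k -> kernel_L2 T (eta_of T k).
Proof. by move=> hk; apply/kernel_L2P => i j; exact: eta_sqint. Qed.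

Lemma emb_eta k : kernel_L2 T k ->
  forall z, ip (emb T (eta_of T k)) z = ip (eta_alg (emb T k)) z.
Proof.
move=> hk; apply/ip_eqP => i j; rewrite comp_emb; last exact: eta_L2.
by apply: ae_mono (entry_eta_ae i j hk) => p ->.
Qed.

Lemma eta_S2 k : kernel_S2 T k -> kernel_S2 T (eta_of T k).
Proof.
move=> hS; have hk : kernel_L2 T k by case: hS.
apply/kernel_S2P; first exact: eta_L2.
have sx : self_adjoint (emb T k) by apply/kernel_S2P.
set x := emb T k in sx.
move=> z; rewrite hstar_adj !emb_eta// -/x /eta_alg !ipNl !ipDl.
by rewrite -!hstar_adj hstarK hstar_mul !sx (hmul_eqr _ _ (hstarK x)).
Qed.

End Eta.

(** * Positivity on kernels and on vector functions *)

Section QuadraticFormsOnSections.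
Context {disp : measure_display} {X : measurableType disp} {R : realType}.
Variable mu : {sigma_finite_measure set X -> \bar R}.
Local Notation mu2 := (mu \x mu)%E.

Lemma ae_Rintegral_ge0 (f : X -> R) : measurable_fun setT f ->
  {ae mu, forall x, 0 <= f x} -> 0 <= \int[mu]_x f x.
Proof.
move=> mf f0; rewrite (@ae_eq_Rintegral _ _ _ _ f (fun x => `|f x|)) //.
- exact: Rintegral_ge0.
- by apply: measurableT_comp.
- by apply: ae_mono f0 => x ?; rewrite ger0_norm.
Qed.

Lemma integrable_sections2 (f g : X * X -> R) : sqint mu2 f -> sqint mu2 g ->
  mu.-integrable setT
    (EFin \o (fun s => l2dot mu (fun t => f (t, s)) (fun t => g (t, s)))).
Proof.
move=> sf sg; have ifg := integrable_mul (sqint_kswap sf) (sqint_kswap sg).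
apply: le_integrable (integrable_fubini_F ifg) => //.
  apply/measurable_EFinP.
  apply: (measurable_parametric_integral2 mu (F := fun p => f p * g p)).
  by apply: measurable_funM; [exact: sf.1|exact: sg.1].
move=> s _; rewrite /l2dot /Rintegral /fubini_F /kswap /=.
by case: (\int[mu]_x _)%E => [r||] //=; rewrite normr0 leey.
Qed.

Lemma l2dot_tensor (a b e : X -> R) : sqint mu a -> sqint mu b -> sqint mu e ->
  l2dot mu2 (fun p => a p.1 * e p.2) (fun p => b p.1 * e p.2) =
  l2dot mu a b * l2dot mu e e.
Proof.
move=> sa sb se; rewrite l2dot_sections1; [|exact: sqint_tensor..].
rewrite [in RHS]/l2dot -RintegralZr//; last exact: integrable_mul.
apply: eq_Rintegral => t _; rewrite -RintegralZl//; last exact: integrable_mul.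
by apply: eq_Rintegral => s _ /=; ring.
Qed.

End QuadraticFormsOnSections.

Section VectorForms.
Context {R : realType} (T : R) (d : nat).
Local Notation mu := (@lebesgue_measure R).
Local Notation mu2 := (mu \x mu)%E.
Local Notation I := (`[0, T]%classic : set R).
Local Notation square := (I `*` I).
Local Notation M := (kernel_matrices T d).

Definition vector_fun : Type := 'I_d -> L2 mu I.
Implicit Types (v w : vector_fun) (x z : M).

Definition vdot v w : R := \sum_i l2dot mu (v i) (w i).

Definition vform x v w : R :=
  \sum_i \sum_j l2dot mu (app mu (comp_of x i j) (v j)) (w i).

Lemma ip_hmul_comp x y z : ip (hmul x y) z =
  \sum_i \sum_k \sum_j l2dot mu2 (comp mu (comp_of x i j) (comp_of y j k)) (comp_of z i k).
Proof. exact: mxip_mulE. Qed.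

(** Left multiplication acts on each column of z separately, so the form of z is the sum over k and
    the integral over s of the forms of its columns. The coefficients cover two uses: 1 and 1 for
    positivity, c and -1 for an upper bound. *)
Lemma vform_ip (a b : R) x : (forall v, 0 <= a * vdot v v + b * vform x v v) ->
  forall z, 0 <= a * ip z z + b * ip (hmul x z) z.
Proof.
move=> xv z; rewrite ip_comp ip_hmul_comp exchange_big [X in b * X]exchange_big /=.
rewrite !mulr_sumr -big_split; apply: sumr_ge0 => k _ /=.
pose G i s := l2dot mu (fun t => comp_of z i k (t, s)) (fun t => comp_of z i k (t, s)).
pose H i j s := l2dot mu (app mu (comp_of x i j) (fun t => comp_of z j k (t, s)))
  (fun t => comp_of z i k (t, s)).
have sz i := comp_sqint z i k.
have sxz i j := @sqint_comp _ _ _ mu _ _ (comp_sqint x i j) (sz j).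
have iG i : mu.-integrable setT (EFin \o G i) by exact: integrable_sections2.
have iH i j : mu.-integrable setT (EFin \o H i j).
  exact: (@integrable_sections2 _ _ _ mu _ _ (sxz i j) (sz i)).
have GE i : l2dot mu2 (comp_of z i k) (comp_of z i k) = \int[mu]_s G i s.
  exact: (@l2dot_sections2 _ _ _ mu).
have HE i j : l2dot mu2 (comp mu (comp_of x i j) (comp_of z j k)) (comp_of z i k) =
    \int[mu]_s H i j s.
  exact: (@l2dot_sections2 _ _ _ mu _ _ (sxz i j) (sz i)).
have iaG i : mu.-integrable setT (EFin \o (fun s => a * G i s)).
  exact: (integrableZl measurableT a (iG i)).
have ibH i j : mu.-integrable setT (EFin \o (fun s => b * H i j s)).
  exact: (integrableZl measurableT b (iH i j)).
have -> : a * \sum_i l2dot mu2 (comp_of z i k) (comp_of z i k) +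
   b * \sum_i \sum_j l2dot mu2 (comp mu (comp_of x i j) (comp_of z j k)) (comp_of z i k) =
   \int[mu]_s (\sum_i a * G i s + \sum_i \sum_j b * H i j s).
  rewrite RintegralD//; [|exact: integrable_finsum|by apply: integrable_finsum => i; exact: integrable_finsum].
  rewrite !Rintegral_sum//; last by move=> i; exact: integrable_finsum.
  rewrite !mulr_sumr; congr (_ + _); apply: eq_bigr => i _.
    by rewrite RintegralZl// GE.
  rewrite mulr_sumr Rintegral_sum//; apply: eq_bigr => j _.
  by rewrite RintegralZl// HE.
apply: ae_Rintegral_ge0.
  have i1 := integrable_finsum iaG.
  have i2 := integrable_finsum (fun i => integrable_finsum (ibH i)).
  apply/measurable_EFinP; exact: (measurable_int mu (integrableD measurableT i1 i2)).
have h := ae_forall (fun i => @sqint_section2 _ _ _ mu _ (sz i)).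
apply: ae_mono h => s szs.
have z0 i t : ~ I t -> comp_of z i k (t, s) = 0.
  by move=> nt; apply: comp_out => -[/= It _]; exact: nt.
have := xv (fun i => mkL2 (szs i) (z0 i)).
rewrite /vdot /vform !mulr_sumr; congr (_ <= _ + _); apply: eq_bigr => i _.
by rewrite mulr_sumr.
Qed.

Let one : R -> R := \1_I.

Let sqint_one : sqint mu one.
Proof.
split; first exact: measurable_indic.
rewrite (_ : (fun t : R => _) = fun r : R => (\1_I r)%:E); last first.
  by apply/funext => r; rewrite /one indicE; case: (_ \in _); rewrite ?expr1n ?expr0n.
rewrite integral_indic// setIT.
suff: (mu I < +oo)%E by [].
by rewrite lebesgue_measure_itv/=; case: ifP => _; rewrite ?ltry.
Qed.

Let one_dot : 0 < T -> l2dot mu one one = T.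
Proof.
move=> T0; rewrite /l2dot /Rintegral (_ : (fun t : R => _) = fun r : R => (\1_I r)%:E); last first.
  by apply/funext => r; rewrite /one indicE; case: (_ \in _); rewrite ?mulr1 ?mulr0.
rewrite integral_indic// setIT.
suff muI : mu I = T%:E by exact: (congr1 fine muI).
by rewrite lebesgue_measure_itv/= lte_fin T0 -EFinB subr0.
Qed.

(* The kernel all of whose columns are v, constant in the second variable. *)
Lemma ip_vform (a b : R) x : 0 < T ->
  (forall z, 0 <= a * ip z z + b * ip (hmul x z) z) ->
  forall v, 0 <= a * vdot v v + b * vform x v v.
Proof.
move=> T0 xz v.
have sv i := L2_sqint (v i).
pose zf i (p : R * R) := v i p.1 * one p.2.
have sz i : sqint mu2 (zf i) by exact: (@sqint_tensor _ _ _ mu).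
have z0 i p : ~ square p -> zf i p = 0.
  move=> np; rewrite /zf /one indicE; case: (boolP (p.2 \in I)) => [/set_mem I2|_].
    by rewrite L2_out ?mul0r// => I1; apply: np.
  by rewrite mulr0.
pose z : M := [ffun p : 'I_d * 'I_d => mkL2 (sz p.1) (@z0 p.1)].
have zE i k : comp_of z i k = zf i :> (R * R -> R) by rewrite /comp_of ffunE.
(* The form of z is d T times that of v, once for each column with T the squared norm of [one]. The
   factor has to be cancelled, so d = 0, where all sums are empty, is set apart. *)
have [d0|d0] := posnP d.
  have noI (i : 'I_d) : False by case: i => i; rewrite d0.
  by rewrite /vdot /vform !big1 ?mulr0 ?addr0// => i _; case: (noI i).
have := xz z; rewrite ip_comp ip_hmul_comp.
have -> : \sum_i \sum_j l2dot mu2 (comp_of z i j) (comp_of z i j) =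
    (d%:R * T) * vdot v v.
  rewrite mulr_sumr; apply: eq_bigr => i _.
  under eq_bigr do rewrite zE (@l2dot_tensor _ _ _ mu _ _ _ (sv i) (sv i) sqint_one) (one_dot T0).
  by rewrite sumr_const card_ord -mulr_natl; ring.
have -> : \sum_i \sum_k \sum_j
    l2dot mu2 (comp mu (comp_of x i j) (comp_of z j k)) (comp_of z i k) =
    (d%:R * T) * vform x v v.
  rewrite mulr_sumr; apply: eq_bigr => i _.
  have xv k j : l2dot mu2 (comp mu (comp_of x i j) (comp_of z j k)) (comp_of z i k) =
      T * l2dot mu (app mu (comp_of x i j) (v j)) (v i).
    rewrite !zE (_ : comp mu _ _ = fun p => app mu (comp_of x i j) (v j) p.1 * one p.2).
      have sa := @sqint_app _ _ _ mu _ _ (comp_sqint x i j) (sv j).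
      by rewrite (@l2dot_tensor _ _ _ mu _ _ _ sa (sv i) sqint_one) (one_dot T0) mulrC.
    apply/funext => -[t s] /=; rewrite /comp /app /zf /one indicE /=.
    case: (s \in I); last first.
      rewrite mulr0 -[RHS](l2dot0r mu (fun u => comp_of x i j (t, u))).
      by congr (l2dot mu _ _); apply/funext => u; rewrite mulr0.
    by rewrite mulr1; congr (l2dot mu _ _); apply/funext => u; rewrite mulr1.
  under eq_bigr do under eq_bigr do rewrite xv.
  by rewrite sumr_const card_ord -mulr_sumr -mulr_natl; ring.
have dT : 0 < d%:R * T by rewrite mulr_gt0// ltr0n.
by rewrite mulrCA (mulrCA b) -mulrDr pmulr_rge0.
Qed.

Lemma nonneg_vform x : 0 < T ->
  nonneg 1 x <-> forall v, 0 <= vdot v v + vform x v v.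
Proof.
move=> T0; split=> [h v|h z].
  rewrite -[vdot v v]mul1r -[vform x v v]mul1r; apply: ip_vform => // z.
  rewrite [X in _ + X]mul1r -(ipZl 1 z z) -ipDl; exact: h.
rewrite ipDl ipZl -[ip (hmul x z) z]mul1r; apply: vform_ip => v.
by rewrite !mul1r.
Qed.

End VectorForms.

(** * Primitives of L2 functions as Cameron-Martin paths *)

Section Paths.
Context {R : realType} (T : R) (d : nat).
Local Notation mu := (@lebesgue_measure R).
Local Notation I := (`[0, T]%classic : set R).
Local Notation path := (R -> 'cV[R]_d).
Implicit Types (v w : vector_fun T d) (h g : path).

Lemma enorm_le_sum p q (A : 'M[R]_(p, q)) : enorm A <= \sum_i \sum_j `|A i j|.
Proof.
have S0 : 0 <= \sum_i \sum_j `|A i j| by do 2 apply: sumr_ge0 => ? _.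
rewrite -(ger0_norm S0) -sqrtr_sqr ler_sqrt ?sqr_ge0// expr2 mulr_suml.
apply: ler_sum => i _; rewrite mulr_suml; apply: ler_sum => j _.
rewrite -(real_normK (num_real (A i j))) expr2 ler_wpM2l//.
rewrite (bigD1 i)//= (bigD1 j)//= -addrA lerDl addr_ge0//.
  by apply: sumr_ge0.
by do 2 apply: sumr_ge0 => ? _.
Qed.

Definition primitive w : path := fun t => \col_i \int[mu]_(s in `[0, t]) w i s.

Definition vec_of w : path := fun t => \col_i w i t.

Let integral_indicT (A : set R) : measurable A ->
  (\int[mu]_t (\1_A t)%:E = mu A)%E.
Proof. by move=> mA; rewrite integral_indic// setIT. Qed.

Let sqint_indic (A : set R) : measurable A -> (mu A < +oo)%E ->
  sqint mu (\1_A : R -> R).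
Proof.
move=> mA Afin; split; first exact: measurable_indic.
rewrite (_ : (fun t : R => _) = fun r : R => (\1_A r)%:E); last first.
  by apply/funext => r; rewrite indicE; case: (_ \in _); rewrite ?expr1n ?expr0n.
by rewrite integral_indic// setIT.
Qed.

Let muI_fin : (mu I < +oo)%E.
Proof. by rewrite lebesgue_measure_itv/=; case: ifP => _; rewrite ?ltry. Qed.

Lemma integrable_vector w i : mu.-integrable setT (EFin \o w i).
Proof.
have := integrable_mul (L2_sqint (w i)) (sqint_indic (measurable_itv _) muI_fin).
apply: eq_integrable => // t _ /=; congr EFin; rewrite indicE.
case: (boolP (t \in I)) => [_|/negP nt]; first by rewrite mulr1.
by rewrite mulr0 L2_out// => It; apply: nt; rewrite inE.
Qed.

Lemma integrable_vector_itv w i (J : interval R) : mu.-integrable [set` J] (EFin \o w i).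
Proof. exact: integrableS (integrable_vector w i). Qed.

Lemma primitive_derivative w : is_L2_derivative T (primitive w) (vec_of w).
Proof.
split.
  apply/(square_integrableP mu) => // i j; rewrite ord1.
  have e : entry I (vec_of w) i 0 = w i.
    apply/funext => t; have [It|nt] := pselect (I t).
      by rewrite entry_in// mxE.
    by rewrite entry_out// L2_out.
  exact: (eq_ind_r (sqint mu) (L2_sqint (w i)) e).
have := ae_forall (fun i => FTC1 (a := BLeft 0)
  (fun y => integrable_vector_itv w i _)
  (open_integrable_locally openT (integrable_vector w i))).
apply: ae_mono => t ft; rewrite /= in_itv/= => /andP[t0 _].
have {}ft i := ft i t0.
have comp_i i j : (fun x => primitive w x i j) = fun y => \int[mu]_(s in `[0, y]) w i s.
  by apply/funext => y; rewrite mxE.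
have dp : derivable (primitive w) t 1.
  by apply/derivable_mxP => i j; rewrite comp_i; have [] := ft i.
split => //; rewrite derive_mx//; apply/matrixP => i j; rewrite !mxE comp_i.
by have [_] := ft i; rewrite derive1E.
Qed.

Lemma primitive_increment w i a b : 0 <= a -> a <= b ->
  primitive w b i 0 - primitive w a i 0 = \int[mu]_(s in `]a, b[) w i s.
Proof.
move=> a0 ab; rewrite !mxE.
rewrite (@Rintegral_itvB _ (w i) (BLeft 0) (BRight b) a)//.
  by rewrite Rintegral_itv_bndo_bndc//; exact: integrable_vector_itv.
exact: integrable_vector_itv.
Qed.

(** Cauchy-Schwarz between |w i| and the sum g of the indicators of the intervals: disjointness
    gives g^2 = g, so the squared norm of g is the total length. *)
Lemma increment_sum_le w i n (a b : 'I_n -> R) :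
  (forall k, 0 <= a k <= b k) ->
  trivIset setT (fun k => `]a k, b k[%classic) ->
  (\sum_k `|primitive w (b k) i 0 - primitive w (a k) i 0|) ^+ 2 <=
  l2dot mu (w i) (w i) * \sum_k (b k - a k).
Proof.
move=> ab dis; pose U k : set R := `]a k, b k[%classic.
have muU k : mu (U k) = (b k - a k)%:E.
  rewrite /U lebesgue_measure_itv/= lte_fin; case: ltP => // ba.
  have /andP[_ abk] := ab k.
  by have -> : b k = a k by [apply/eqP; rewrite eq_le ba abk]; rewrite subrr.
have mU k : measurable (U k) by exact: measurable_itv.
have sU k : sqint mu (\1_(U k) : R -> R) by apply: sqint_indic; rewrite ?muU ?ltry.
pose g (t : R) : R := \sum_k \1_(U k) t.
have sg : sqint mu g by exact: sqint_sum.
have gg : l2dot mu g g = \sum_k (b k - a k).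
  have -> : l2dot mu g g = \int[mu]_t g t.
    apply: eq_Rintegral => t _; rewrite /g mulr_suml; apply: eq_bigr => k _.
    rewrite (bigD1 k)//= mulrDr mulr_sumr big1 ?addr0.
      by rewrite indicE; case: (_ \in _); rewrite ?mulr1 ?mulr0.
    move=> l lk; rewrite !indicE -natrM mulnb; apply/eqP; rewrite pnatr_eq0 eqb0.
    apply: contra lk => /andP[/set_mem tk /set_mem tl]; apply/eqP.
    by apply: dis => //; exists t.
  rewrite /g Rintegral_sum.
    apply: eq_bigr => k _.
    have e : (\int[mu]_t (\1_(U k) t)%:E = (b k - a k)%:E)%E.
      exact: (etrans (integral_indicT (mU k)) (muU k)).
    exact: (congr1 fine e).
  move=> k; have := integrable_sqr (sU k); apply: eq_integrable => // t _ /=.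
  by rewrite indicE; case: (_ \in _); rewrite ?expr1n ?expr0n.
rewrite -gg; pose f (t : R) : R := `|w i t|.
have sf : sqint mu f by apply: sqint_norm; exact: L2_sqint.
have <- : l2dot mu f f = l2dot mu (w i) (w i).
  by apply: eq_Rintegral => t _; rewrite /f -!expr2 real_normK// num_real.
apply: le_trans (l2dot_cauchy_schwarz sf sg).
rewrite lerXn2r// ?nnegrE.
- by apply: sumr_ge0.
- apply: Rintegral_ge0 => t _; apply: mulr_ge0; first exact: normr_ge0.
  by apply: sumr_ge0 => k _; rewrite indicE.
have -> : l2dot mu f g = \sum_k l2dot mu f (\1_(U k)).
  rewrite /l2dot -Rintegral_sum; last by move=> k; exact: integrable_mul.
  by apply: eq_Rintegral => t _; rewrite /g mulr_sumr.
apply: ler_sum => k _; have /andP[a0 abk] := ab k; rewrite primitive_increment//.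
have iU : mu.-integrable (U k) (EFin \o w i) by exact: integrable_vector_itv.
apply: (@le_trans _ _ (\int[mu]_(t in U k) f t)).
  exact: (@le_normr_Rintegral _ _ _ mu (U k) (w i) (mU k) iU).
rewrite Rintegral_mkcond /l2dot le_eqVlt; apply/orP; left; apply/eqP.
apply: eq_Rintegral => t _; rewrite patchE indicE /f.
by case: ifP => _; rewrite ?mulr1 ?mulr0.
Qed.

Lemma primitive_continuous w : absolutely_continuous T (primitive w).
Proof.
move=> eps eps0.
(* The 1 keeps K positive when w vanishes; likewise [d.+1] below allows d = 0 and makes the sum of d
   bounds strictly smaller than [eps]. *)
pose K : R := 1 + \sum_i l2dot mu (w i) (w i).
have K0 : 0 < K by rewrite ltr_pwDl// sumr_ge0// => i _; exact: l2dot_ge0.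
have wK i : l2dot mu (w i) (w i) <= K.
  rewrite /K (bigD1 i)//= addrCA lerDl addr_ge0// sumr_ge0// => j _.
  exact: l2dot_ge0.
pose e := eps / d.+1%:R.
have e0 : 0 < e by rewrite divr_gt0.
exists (e ^+ 2 / K); first by rewrite divr_gt0// exprn_gt0.
move=> n a b abT dis; set L := \sum_(i < n) (b i - a i) => Ld.
have ab k : 0 <= a k <= b k by have [-> ->] := abT k.
have L0 : 0 <= L by apply: sumr_ge0 => k _; rewrite subr_ge0; have [] := abT k.
pose S i := \sum_k `|primitive w (b k) i 0 - primitive w (a k) i 0|.
have S0 i : 0 <= S i by apply: sumr_ge0.
have Se i : S i <= e.
  suff: S i ^+ 2 <= e ^+ 2 by rewrite ler_pXn2r ?nnegrE ?S0 ?(ltW e0).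
  apply: (@le_trans _ _ (l2dot mu (w i) (w i) * L)).
    exact: increment_sum_le ab dis.
  apply: (le_trans (ler_wpM2r L0 (wK i))).
  by rewrite mulrC -ler_pdivlMr// ltW.
apply: (@le_lt_trans _ _ (\sum_i S i)).
  rewrite exchange_big /=; apply: ler_sum => k _.
  apply: (le_trans (enorm_le_sum _)); apply: ler_sum => i _.
  have subE (A B : 'cV[R]_d) : (A - B) i 0 = A i 0 - B i 0 by rewrite !mxE.
  by rewrite big_ord1 subE.
apply: (@le_lt_trans _ _ (\sum_(i < d) e)); first exact: ler_sum.
rewrite sumr_const card_ord -mulr_natl /e mulrCA -[ltRHS]mulr1 ltr_pM2l//.
by rewrite ltr_pdivrMr// mul1r ltr_nat.
Qed.

Lemma primitive_cameron_martin w : cameron_martin T (primitive w).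
Proof.
split; first exact: primitive_continuous.
  apply/matrixP => i j; rewrite !mxE.
  by rewrite set_itv1 Rintegral_set1.
by exists (vec_of w); exact: primitive_derivative.
Qed.

End Paths.

(** * Inner products and forms in terms of derivatives *)

Section CameronMartinForms.
Context {R : realType} (T : R) (d : nat).
Local Notation mu := (@lebesgue_measure R).
Local Notation mu2 := (mu \x mu)%E.
Local Notation I := (`[0, T]%classic : set R).
Local Notation square := (I `*` I).
Local Notation path := (R -> 'cV[R]_d).
Local Notation M := (kernel_matrices T d).
Implicit Types (h g f : path) (w : vector_fun T d) (x y : M) (k : R * R -> 'M[R]_d).

(* Outside L2 this is the zero vector. *)
Definition vemb (v : path) : vector_fun T d :=
  fun i => insubd (0 : L2 mu I) (entry I v i 0).

Definition deriv_vec h : vector_fun T d := vemb (cm_deriv T h).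

Definition has_L2_derivative h := exists v, is_L2_derivative T h v.

Lemma cameron_martin_has h : cameron_martin T h -> has_L2_derivative h.
Proof. by case. Qed.

Lemma cm_derivP h : has_L2_derivative h -> is_L2_derivative T h (cm_deriv T h).
Proof. exact: getPex. Qed.

Lemma sqint_vector v i : square_integrable mu I v -> sqint mu (entry I (v : path) i 0).
Proof. by move/(square_integrableP mu (measurable_itv _)); exact. Qed.

Lemma vembE v i : square_integrable mu I v -> vemb v i = entry I v i 0 :> (R -> R).
Proof.
move=> sv; rewrite /vemb.
suff l : entry I v i 0 \in l2on mu I by rewrite insubdK.
by apply/asboolP; split; [exact: sqint_vector|move=> p; exact: entry_out].
Qed.

Let ae_neq (a : R) : {ae mu, forall t, t <> a}.
Proof.
exists [set a]; split; first exact: measurable_set1.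
  exact: lebesgue_measure_set1.
by move=> t /= /contrapT.
Qed.

(** Derivatives at a point are unique and the two endpoints form a null set. Since [cm_deriv] takes
    an arbitrary representative by [get], every computation with it goes through this lemma. *)
Lemma L2_derivative_unique h u v : is_L2_derivative T h u -> is_L2_derivative T h v ->
  forall i, {ae mu, forall t, vemb u i t = vemb v i t}.
Proof.
move=> [su du] [sv dv] i; rewrite !vembE//.
have n0T : {ae mu, forall t, t <> 0 /\ t <> T}.
  by apply: ae_mono2 (ae_neq 0) (ae_neq T) => t.
have uv : {ae mu, forall t, `]0, T[%classic t -> u t = v t}.
  apply: ae_mono2 du dv => t du dv tT.
  by have [_ <-] := du tT; have [_ <-] := dv tT.
apply: ae_mono2 n0T uv => t [t0 tT] uv.
have [It|nt] := pselect (I t); last by rewrite !entry_out.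
rewrite !entry_in// uv//=; move: It; rewrite /= !in_itv/= => /andP[t0' tT'].
rewrite !lt_def t0' tT' !andbT; apply/andP; split; apply/eqP => // tTE.
exact: tT.
Qed.

Lemma L2_derivativeD h g u v : is_L2_derivative T h u -> is_L2_derivative T g v ->
  is_L2_derivative T (h \+ g) (u \+ v).
Proof.
move=> [su du] [sv dv]; split.
  apply/(square_integrableP mu) => // i j; rewrite ord1.
  have e : entry I (u \+ v) i 0 = fun t => entry I u i 0 t + entry I v i 0 t.
    apply/funext => t; have [It|nt] := pselect (I t).
      by rewrite !entry_in// mxE.
    by rewrite !entry_out// addr0.
  exact: (eq_ind_r (sqint mu) (sqintD (sqint_vector i su) (sqint_vector i sv)) e).
apply: ae_mono2 du dv => t du dv tT.
by have h1 := du tT; have h2 := dv tT; exact: is_deriveD.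
Qed.

Lemma vdotC (v w : vector_fun T d) : vdot v w = vdot w v :> R.
Proof. by apply: eq_bigr => i _; exact: l2dotC. Qed.

Lemma vdot_ae (v v' w : vector_fun T d) : (forall i, {ae mu, forall t, v i t = v' i t}) ->
  vdot v w = vdot v' w :> R.
Proof.
move=> vv; apply: eq_bigr => i _.
exact: (ae_eq_l2dot (L2_sqint (v i)) (L2_sqint (v' i)) (L2_sqint (w i)) (vv i)).
Qed.

Lemma cm_innerE h g : has_L2_derivative h -> has_L2_derivative g ->
  cm_inner T h g = vdot (deriv_vec h) (deriv_vec g).
Proof.
move=> /cm_derivP[sh _] /cm_derivP[sg _].
have eh i : deriv_vec h i = entry I (cm_deriv T h) i 0 :> (R -> R) := vembE i sh.
have eg i : deriv_vec g i = entry I (cm_deriv T g) i 0 :> (R -> R) := vembE i sg.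
rewrite /cm_inner Rintegral_mkcond /vdot /l2dot -Rintegral_sum.
  apply: eq_Rintegral => t _; rewrite patchE.
  case: ifPn => [/set_mem It|nt].
    by apply: eq_bigr => i _; rewrite eh eg !entry_in.
  rewrite big1// => i _; rewrite eh entry_out ?mul0r// => It.
  by move: nt; rewrite mem_set.
by move=> i; exact: (integrable_mul (L2_sqint _) (L2_sqint _)).
Qed.

(** Only almost everywhere, because of the choice made by [cm_deriv]; [vdot_ae] and [vform_ae] show
    that the forms do not see the difference. *)
Lemma deriv_vec_primitive w i : {ae mu, forall t, deriv_vec (primitive w) i t = w i t}.
Proof.
have dw := primitive_derivative w.
have := L2_derivative_unique (cm_derivP (ex_intro _ _ dw)) dw i.
apply: ae_mono => t; rewrite /deriv_vec => ->; rewrite vembE; last by case: dw.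
have [It|nt] := pselect (I t); first by rewrite entry_in// mxE.
by rewrite entry_out// L2_out.
Qed.

Lemma deriv_vecD h g i : has_L2_derivative h -> has_L2_derivative g ->
  {ae mu, forall t, deriv_vec (h \+ g) i t = deriv_vec h i t + deriv_vec g i t}.
Proof.
move=> /cm_derivP dh /cm_derivP dg; have dhg := L2_derivativeD dh dg.
have := L2_derivative_unique (cm_derivP (ex_intro _ _ dhg)) dhg i.
apply: ae_mono => t; rewrite /deriv_vec => ->.
rewrite !vembE; [|by case: dg|by case: dh|by case: dhg].
have [It|nt] := pselect (I t); first by rewrite !entry_in// mxE.
by rewrite !entry_out// addr0.
Qed.

(** As a pairing of the kernel with a tensor in L2 of the square, the form visibly depends on the
    kernel and on the vectors only up to null sets. *)
Lemma l2dot_app (kk : R * R -> R) (a b : R -> R) : sqint mu2 kk -> sqint mu a -> sqint mu b ->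
  l2dot mu (app mu kk a) b = l2dot mu2 kk (fun p => b p.1 * a p.2).
Proof.
move=> sk sa sb; have sab := @sqint_tensor _ _ _ mu _ _ sb sa.
rewrite (@l2dot_sections1 _ _ _ mu _ _ sk sab).
apply: (@ae_eq_Rintegral _ _ _ mu).
- by apply: measurable_funM; [exact: (@sqint_app _ _ _ mu _ _ sk sa).1|exact: sb.1].
- apply: (measurable_parametric_integral mu (F := fun p => kk p * (b p.1 * a p.2))).
  by apply: measurable_funM; [exact: sk.1|exact: sab.1].
apply: ae_mono (@sqint_section1 _ _ _ mu _ sk) => t st.
rewrite /app {1}/l2dot -(@RintegralZr _ _ _ mu)//; last exact: integrable_mul.
by apply: eq_Rintegral => s _ /=; ring.
Qed.

Lemma vformE x (v w : vector_fun T d) : vform x v w =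
  \sum_i \sum_j l2dot mu2 (comp_of x i j) (fun p => w i p.1 * v j p.2).
Proof.
apply: eq_bigr => i _; apply: eq_bigr => j _.
exact: (l2dot_app (comp_sqint x i j) (L2_sqint (v j)) (L2_sqint (w i))).
Qed.

Lemma sqint_vtensor (v w : vector_fun T d) i j : sqint mu2 (fun p : R * R => w i p.1 * v j p.2).
Proof. exact: (@sqint_tensor _ _ _ mu _ _ (L2_sqint (w i)) (L2_sqint (v j))). Qed.

Lemma vform_eq x y (v w : vector_fun T d) : (forall z, ip x z = ip y z) -> vform x v w = vform y v w.
Proof.
move=> /ip_eqP xy; rewrite !vformE; apply: eq_bigr => i _; apply: eq_bigr => j _.
exact: (ae_eq_l2dot (comp_sqint x i j) (comp_sqint y i j) (sqint_vtensor v w i j) (xy i j)).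
Qed.

Lemma vform_ae x (v v' w w' : vector_fun T d) : (forall i, {ae mu, forall t, v i t = v' i t}) ->
  (forall i, {ae mu, forall t, w i t = w' i t}) -> vform x v w = vform x v' w'.
Proof.
move=> vv ww; rewrite !vformE; apply: eq_bigr => i _; apply: eq_bigr => j _.
rewrite l2dotC [RHS]l2dotC.
apply: (ae_eq_l2dot (sqint_vtensor v w i j) (sqint_vtensor v' w' i j) (comp_sqint x i j)).
have h1 := @ae_prod1 _ _ _ mu _ (ww i); have h2 := @ae_prod2 _ _ _ mu _ (vv j).
by apply: ae_mono2 h1 h2 => p -> ->.
Qed.

End CameronMartinForms.

(** * The operators [hs_op] and their quadratic forms *)

Section HilbertSchmidtOperators.
Context {R : realType} (T : R) (d : nat).
Local Notation mu := (@lebesgue_measure R).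
Local Notation mu2 := (mu \x mu)%E.
Local Notation I := (`[0, T]%classic : set R).
Local Notation square := (I `*` I).
Local Notation path := (R -> 'cV[R]_d).
Local Notation M := (kernel_matrices T d).
Implicit Types (h g f : path) (v w : vector_fun T d) (x y : M) (k : R * R -> 'M[R]_d).

(** The sum over j may be taken out of the inner integral for those t whose rows are square
    integrable, hence for almost every t. *)
Lemma hs_formE k h g : kernel_L2 T k -> has_L2_derivative T h -> has_L2_derivative T g ->
  hs_form T k h g = vform (emb T k) (deriv_vec T h) (deriv_vec T g).
Proof.
move=> hk /cm_derivP[sh _] /cm_derivP[sg _].
have eh i : deriv_vec T h i = entry I (cm_deriv T h) i 0 :> (R -> R) := vembE i sh.
have eg i : deriv_vec T g i = entry I (cm_deriv T g) i 0 :> (R -> R) := vembE i sg.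
pose x := emb T k; set v := deriv_vec T h in eh *; set w := deriv_vec T g in eg *.
have ek i j : comp_of x i j = entry square k i j :> (R * R -> R) := comp_emb i j hk.
pose J i t : R := \int[mu]_s \sum_j comp_of x i j (t, s) * v j s.
have -> : hs_form T k h g = \int[mu]_t \sum_i J i t * w i t.
  rewrite /hs_form Rintegral_mkcond; apply: eq_Rintegral => t _; rewrite patchE.
  case: ifPn => [/set_mem It|nt].
    apply: eq_bigr => i _; rewrite eg entry_in// mxE; congr (_ * _).
    rewrite Rintegral_mkcond; apply: eq_Rintegral => s _; rewrite patchE.
    case: ifPn => [/set_mem Is|ns].
      by rewrite mxE; apply: eq_bigr => j _; rewrite ek eh !entry_in.
    rewrite big1// => j _; rewrite eh [X in _ * X]entry_out ?mulr0// => Is.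
    by move: ns; rewrite mem_set.
  rewrite big1// => i _; rewrite eg entry_out ?mulr0// => It.
  by move: nt; rewrite mem_set.
have sx i j := comp_sqint x i j.
have sa i j : sqint mu (app mu (comp_of x i j) (v j)).
  exact: (@sqint_app _ _ _ mu _ _ (sx i j) (L2_sqint (v j))).
have iF i j : mu.-integrable setT
    (EFin \o (fun t => app mu (comp_of x i j) (v j) t * w i t)).
  exact: (integrable_mul (sa i j) (L2_sqint (w i))).
have iFs i := integrable_finsum (iF i).
rewrite /vform /l2dot.
transitivity (\int[mu]_t \sum_i \sum_j app mu (comp_of x i j) (v j) t * w i t).
  apply: (@ae_eq_Rintegral _ _ _ mu).
  - apply: measurable_sum => i; apply: measurable_funM; last exact: (L2_sqint (w i)).1.
    apply: (measurable_parametric_integral mu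
      (F := fun p => \sum_j comp_of x i j p * v j p.2)).
    apply: measurable_sum => j; apply: measurable_funM; first exact: (sx i j).1.
    by apply: (measurableT_comp (L2_sqint (v j)).1); exact: measurable_snd.
  - by apply/measurable_EFinP; exact: (measurable_int mu (integrable_finsum iFs)).
  have := ae_forall (fun i => ae_forall (fun j => @sqint_section1 _ _ _ mu _ (sx i j))).
  apply: ae_mono => t st; apply: eq_bigr => i _; rewrite -mulr_suml; congr (_ * _).
  rewrite /J Rintegral_sum// => j.
  exact: (integrable_mul (st i j) (L2_sqint (v j))).
by rewrite Rintegral_sum//; apply: eq_bigr => i _; rewrite Rintegral_sum.
Qed.

Lemma app_out x v i j t : ~ I t -> app mu (comp_of x i j) (v j) t = 0.
Proof.
move=> nt; rewrite /app l2dotC (_ : (fun s => _) = fun=> 0) ?l2dot0r//.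
by apply/funext => s; apply: comp_out => -[].
Qed.

Definition app_vec x v : vector_fun T d := fun i => \sum_j
  mkL2 (@sqint_app _ _ _ mu _ _ (comp_sqint x i j) (L2_sqint (v j)))
    (@app_out x v i j).

Lemma vdot_app_vec x v w : vdot (app_vec x v) w = vform x v w.
Proof.
apply: eq_bigr => i _; rewrite /l2dot -Rintegral_sum.
  apply: eq_Rintegral => t _; rewrite /app_vec -mulr_suml; congr (_ * _).
  exact: L2_sumE.
move=> j; apply: integrable_mul; last exact: L2_sqint.
exact: (@sqint_app _ _ _ mu _ _ (comp_sqint x i j) (L2_sqint (v j))).
Qed.

(** [hs_op] is a [get], so a witness is required: the primitive of the kernel applied to the
    derivative of h represents the form explicitly. *)
Lemma hs_opP k h : kernel_L2 T k -> cameron_martin T h ->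
  cameron_martin T (hs_op T k h) /\
  forall g, cameron_martin T g -> cm_inner T (hs_op T k h) g = hs_form T k h g.
Proof.
move=> hk ch.
suff: exists f, cameron_martin T f /\
  forall g, cameron_martin T g -> cm_inner T f g = hs_form T k h g by exact: getPex.
exists (primitive (app_vec (emb T k) (deriv_vec T h))).
have cp := primitive_cameron_martin (app_vec (emb T k) (deriv_vec T h)).
split=> // g cg; have dh := cameron_martin_has ch; have dg := cameron_martin_has cg.
rewrite (cm_innerE (cameron_martin_has cp) dg) (hs_formE hk dh dg) -vdot_app_vec.
by apply: vdot_ae => i; exact: deriv_vec_primitive.
Qed.

Lemma cm_inner_hs_op k h g : kernel_L2 T k -> cameron_martin T h -> cameron_martin T g ->
  cm_inner T (hs_op T k h) g = vform (emb T k) (deriv_vec T h) (deriv_vec T g).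
Proof.
move=> hk ch cg; rewrite (hs_opP hk ch).2//.
by apply: hs_formE; [| exact: cameron_martin_has..].
Qed.

Lemma cm_nonneg_vform k : kernel_L2 T k ->
  cm_nonneg T (fun h => h \+ hs_op T k h) <->
  forall v, 0 <= vdot v v + vform (emb T k) v v.
Proof.
move=> hk.
have innerE h : cameron_martin T h -> cm_inner T (h \+ hs_op T k h) h =
    vdot (deriv_vec T h) (deriv_vec T h) +
    vform (emb T k) (deriv_vec T h) (deriv_vec T h).
  move=> ch; have [cB _] := hs_opP hk ch.
  have dh := cameron_martin_has ch; have dB := cameron_martin_has cB.
  rewrite -(cm_inner_hs_op hk ch ch) (cm_innerE dB dh).
  have dhB : has_L2_derivative T (h \+ hs_op T k h).
    by exists (cm_deriv T h \+ cm_deriv T (hs_op T k h));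
      apply: L2_derivativeD; exact: cm_derivP.
  rewrite (cm_innerE dhB dh) -big_split; apply: eq_bigr => i _ /=.
  rewrite /l2dot -(@RintegralD _ _ _ mu)//;
    try exact: (integrable_mul (L2_sqint _) (L2_sqint _)).
  apply: (@ae_eq_Rintegral _ _ _ mu).
  - by apply: measurable_funM; exact: (L2_sqint _).1.
  - by apply: measurable_funD; apply: measurable_funM; exact: (L2_sqint _).1.
  by apply: ae_mono (deriv_vecD i dh dB) => t ->; rewrite mulrDl.
split=> [nn v|nn h ch]; last by rewrite innerE.
have cv := primitive_cameron_martin v.
have := nn _ cv; rewrite innerE//.
have pv i := deriv_vec_primitive v i.
by rewrite (vdot_ae _ pv) (vdotC v) (vdot_ae _ pv) (vform_ae (emb T k) pv pv).
Qed.

End HilbertSchmidtOperators.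

(** * The bound from Lambda, and the two halves of the bijection *)

Section Spectrum.
Context {R : realType} (T : R) (d : nat).
Local Notation mu := (@lebesgue_measure R).
Local Notation mu2 := (mu \x mu)%E.
Local Notation M := (kernel_matrices T d).
Implicit Types (v w : vector_fun T d) (x y : M) (k : R * R -> 'M[R]_d).

Lemma vdot_ge0 v : 0 <= vdot v v.
Proof. by apply: sumr_ge0 => i _; exact: l2dot_ge0. Qed.

Lemma vdot_scale (c : R) v : vdot (fun i => c *: v i) (fun i => c *: v i) = c ^+ 2 * vdot v v.
Proof.
rewrite /vdot mulr_sumr; apply: eq_bigr => i _.
have iv := integrable_mul (L2_sqint (v i)) (L2_sqint (v i)).
rewrite /l2dot -(@RintegralZl _ _ _ mu)//; apply: eq_Rintegral => t _.
have -> : (c *: v i) t = c * v i t by [].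
by ring.
Qed.

Lemma vform_scale (c : R) x v :
  vform x (fun i => c *: v i) (fun i => c *: v i) = c ^+ 2 * vform x v v.
Proof.
rewrite !vformE mulr_sumr; apply: eq_bigr => i _; rewrite mulr_sumr.
apply: eq_bigr => j _; have ixv := integrable_mul (comp_sqint x i j) (sqint_vtensor v v i j).
rewrite /l2dot -(@RintegralZl _ _ _ mu2)//; apply: eq_Rintegral => p _.
have E l t : (c *: v l) t = c * v l t by [].
by rewrite !E; ring.
Qed.

Lemma vform_le_norm0 x v : vdot v v = 0 -> vform x v v = 0.
Proof.
move=> /eqP; rewrite psumr_eq0 => [/allP v0|i _]; last exact: l2dot_ge0.
pose z : vector_fun T d := fun=> 0.
have ae0 i : {ae mu, forall t, v i t = z i t}.
  by have /eqP/(l2dot_eq0 (L2_sqint (v i))) := v0 i (mem_index_enum i).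
rewrite (vform_ae x ae0 ae0); apply: big1 => i _; apply: big1 => j _.
exact: l2dot0r.
Qed.

(** By homogeneity: v is scaled to norm 1 and its primitive tested in the supremum. A v of norm zero
    cannot be scaled, but its form vanishes. *)
Lemma cm_Lambda_lt1 k : kernel_L2 T k -> (cm_Lambda T (hs_op T k) < 1)%E ->
  exists2 c, c < 1 & forall v, vform (emb T k) v v <= c * vdot v v.
Proof.
move=> hk L1.
have bound (c : R) : (cm_Lambda T (hs_op T k) <= c%:E)%E ->
    forall v, vform (emb T k) v v <= c * vdot v v.
  move=> Lc v; have := vdot_ge0 v; rewrite le_eqVlt => /orP[/eqP v0|v0].
    by rewrite vform_le_norm0// -v0 mulr0.
  pose a := (Num.sqrt (vdot v v))^-1.
  have a2 : a ^+ 2 = (vdot v v)^-1 by rewrite exprVn sqr_sqrtr// ltW.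
  pose u : vector_fun T d := fun i => a *: v i.
  have pu i := deriv_vec_primitive u i.
  have cu := primitive_cameron_martin u; have du := cameron_martin_has cu.
  have n1 : cm_norm T (primitive u) = 1.
    rewrite /cm_norm (cm_innerE du du) (vdot_ae _ pu) vdotC (vdot_ae _ pu).
    by rewrite vdot_scale a2 mulVf ?gt_eqF// sqrtr1.
  have := ereal_sup_ubound (ex_intro2 _ _ _ (conj cu n1) erefl) :
    ((cm_inner T (hs_op T k (primitive u)) (primitive u))%:E <= cm_Lambda T (hs_op T k))%E.
  move=> /le_trans/(_ Lc); rewrite lee_fin (cm_inner_hs_op hk cu cu).
  rewrite (vform_ae _ pu pu) vform_scale a2 mulrC.
  by rewrite ler_pdivrMr.
(* A finite supremum is itself the constant and +oo contradicts the hypothesis. For -oo any constant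
   is a bound, and 0 is taken. *)
move: L1 bound; case: (cm_Lambda _ _) => [r|//|]; last first.
  by move=> _ bound; exists 0 => //; apply: bound; exact: leNye.
by rewrite lte_fin => r1 bound; exists r => //; exact: bound.
Qed.

Lemma cm_Lambda_eq k k' : kernel_L2 T k -> kernel_L2 T k' -> kernel_eq T k k' ->
  cm_Lambda T (hs_op T k) = cm_Lambda T (hs_op T k').
Proof.
move=> hk hk' kk'; have kk := (kernel_eqP hk hk').1 kk'.
rewrite /cm_Lambda; apply: (congr1 (@ereal_sup R)).
apply: eq_imagel => h [ch _].
apply: (congr1 EFin); apply: (etrans (cm_inner_hs_op hk ch ch)).
exact: (etrans (vform_eq _ _ kk) (esym (cm_inner_hs_op hk' ch ch))).
Qed.

Lemma eta_alg_sqr x z : self_adjoint x ->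
  2 * ip x z + ip (hmul x x) z = - ip (eta_alg x) z.
Proof.
move=> sx; rewrite /eta_alg ipNl !ipDl opprK sx (hmul_eql _ _ sx).
by rewrite mulr_natl mulr2n.
Qed.

Lemma emb_S2 k : kernel_S2 T k -> self_adjoint (emb T k).
Proof. by move=> sk; apply/kernel_S2P; case: (sk). Qed.

Lemma eta_injective k1 k2 : 0 < T -> kernel_S2plus T k1 -> kernel_S2plus T k2 ->
  kernel_eq T (eta_of T k1) (eta_of T k2) -> kernel_eq T k1 k2.
Proof.
move=> T0 [s1 n1] [s2 n2]; have h1 := s1.1; have h2 := s2.1.
move=> /(kernel_eqP (eta_L2 h1) (eta_L2 h2)).1 e12.
apply: (kernel_eqP h1 h2).2 => z; have sx1 := emb_S2 s1; have sx2 := emb_S2 s2.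
have nx1 := (nonneg_vform (emb T k1) T0).2 ((cm_nonneg_vform h1).1 n1).
have nx2 := (nonneg_vform (emb T k2) T0).2 ((cm_nonneg_vform h2).1 n2).
apply: subr0_eq; rewrite -ipBl; apply: ip_eq0l.
apply: (square_root_unique sx1 sx2 nx1 nx2) => z'.
apply: (etrans (eta_alg_sqr z' sx1) (etrans _ (esym (eta_alg_sqr z' sx2)))).
apply: (congr1 -%R).
exact: (etrans (esym (emb_eta h1 z')) (etrans (e12 z') (emb_eta h2 z'))).
Qed.

Lemma eta_surjective (eta : R * R -> 'M[R]_d) : 0 < T -> kernel_S2_hat T eta ->
  exists2 k, kernel_S2plus_hat T k & kernel_eq T eta (eta_of T k).
Proof.
move=> T0 [se L1]; have he := se.1; have sa := emb_S2 se.
have [c c1 ec] := cm_Lambda_lt1 he L1.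
have [x [sx nx xE]] : exists x, [/\ self_adjoint x, nonneg 1 x &
    forall z, 2 * ip x z + ip (hmul x x) z = ip (- emb T eta) z].
  (* Here s = - eta, and the bound c < 1 on the form of eta makes 1 - c > 0 a lower bound of S = 1 -
     eta. *)
  apply: (@square_root_exists _ _ _ (1 - c)); first by rewrite subr_gt0.
    by move=> z; rewrite hstar_adj !ipNl -hstar_adj sa.
  move=> z; have := @vform_ip _ T d c (-1) (emb T eta) _ z.
  rewrite ipDl ipZl => h.
  have -> : ip (hmul (- emb T eta) z) z = - ip (hmul (emb T eta) z) z.
    by rewrite -scaleN1r hmulZl mulN1r.
  have {}h : 0 <= c * ip z z + -1 * ip (hmul (emb T eta) z) z.
    by apply: h => v; rewrite mulN1r subr_ge0.
  by rewrite mulrBl lerD2l lerN2 -subr_ge0 -mulN1r.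
pose k := unemb x; have hk : kernel_L2 T k := unemb_L2 x.
have ek : emb T k = x := emb_unemb x.
have ee : kernel_eq T eta (eta_of T k).
  apply: (kernel_eqP he (eta_L2 hk)).2 => z.
  rewrite (emb_eta hk) ek; apply: oppr_inj.
  apply: (etrans (esym (ipNl _ _))).
  exact: (etrans (esym (xE z)) (eta_alg_sqr z sx)).
exists k; last exact: ee.
split; last first.
  (* Lambda depends on the kernel only up to equality in L2, so the strict bound passes from eta to
     [eta_of T k]. *)
  exact: (eq_ind _ (fun L => (L < 1)%E) L1 _ (cm_Lambda_eq he (eta_L2 hk) ee)).
split; first by apply: (kernel_S2P hk).2; rewrite ek.
by apply: (cm_nonneg_vform hk).2; rewrite ek; exact: (nonneg_vform x T0).1 nx.
Qed.

End Spectrum.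

Theorem proposition3p1 (R : realType) (T : R) (d : nat) (hT : 0 < T) :
  (forall k1 k2 : R * R -> 'M[R]_d,
     kernel_S2plus T k1 -> kernel_S2plus T k2 ->
     kernel_eq T (eta_of T k1) (eta_of T k2) -> kernel_eq T k1 k2)
  /\
  [/\ forall k : R * R -> 'M[R]_d,
        kernel_S2plus_hat T k -> kernel_S2_hat T (eta_of T k),
      forall k1 k2 : R * R -> 'M[R]_d,
        kernel_S2plus_hat T k1 -> kernel_S2plus_hat T k2 ->
        kernel_eq T (eta_of T k1) (eta_of T k2) -> kernel_eq T k1 k2
    & forall eta : R * R -> 'M[R]_d, kernel_S2_hat T eta ->
        exists2 k : R * R -> 'M[R]_d,
          kernel_S2plus_hat T k & kernel_eq T eta (eta_of T k)].
Proof.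
split; first by move=> k1 k2; exact: eta_injective.
split; last by move=> eta; exact: eta_surjective.
- by move=> k [[sk _] L]; split=> //; exact: eta_S2.
- by move=> k1 k2 [p1 _] [p2 _]; exact: eta_injective.
Qed.
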